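(* Let $\pi : E \to B$ be a diffeological bundle, let $e \in E$ and $b = \pi(e)$, and let $\iota : F \to E$ be the inclusion of the fiber $F = \pi^{-1}(b)$ over $b$ (with the sub-diffeology). Then $$T_e(F) \xrightarrow{\ \iota_*\ } T_e(E) \xrightarrow{\ \pi_*\ } T_b(B) \to 0$$ is an exact sequence of real vector spaces. Moreover, both $\pi_* : T_e^H(E) \to T_b^H(B)$ and $\pi_* : T_e^{dvs}(E) \to T_b^{dvs}(B)$ are subductions.
   Context: A diffeological space is a set $X$ with, for each $n \ge 0$ and each open $U \subseteq \mathbb{R}^n$, a specified set of functions $U \to X$ called plots, such that: every constant function $U\to X$ is a plot; if $U \to X$ is a plot and $V \to U$ is a smooth map between open subsets of Euclidean spaces, the composite $V \to X$ is a plot; and a function $U \to X$ whose restriction to each member of some open cover of $U$ is a plot is itself a plot. A function $f : X \to Y$ is smooth if $f \circ p$ is a plot of $Y$ for every plot $p$ of $X$; all maps between diffeological spaces are assumed smooth. Isomorphisms are called diffeomorphisms. A subset $A \subseteq X$ carries the sub-diffeology (plots are the functions $U \to A$ whose composite to $X$ is a plot); products and pullbacks carry the product diffeology and its sub-diffeology. A subduction is a smooth surjection $X \to Y$ such that the plots of $Y$ are exactly the functions $U \to Y$ that locally lift to plots of $X$. A diffeological bundle with fiber $F$ is a smooth map $f : X \to Y$ such that for every plot $p : U \to Y$ the pullback $p^*(f)$ is locally trivial with fiber $F$, i.e. there is an open cover $U = \bigcup_i U_i$ such that the restriction of $p^*(f)$ to each $U_i$ is diffeomorphic, over $U_i$,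 to $U_i \times F$. A pointed plot $p : (U,0) \to (X,x)$ is a plot $p:U\to X$ where $U$ is a connected open neighbourhood of $0$ in some $\mathbb{R}^n$ and $p(0) = x$. The germ category $\mathcal{G}(X,x)$ has the pointed plots as objects; a morphism from $p : (U,0)\to (X,x)$ to $q : (V,0) \to (X,x)$ is the germ at $0$ of a smooth map $f : W \to V$, with $W$ an open neighbourhood of $0$ in $U$, $f(0)=0$ and $p|_W = q \circ f$. The internal tangent space $T_x(X)$ is the colimit, in real vector spaces, of the functor $\mathcal{G}(X,x) \to \mathrm{Vect}$ sending $p : (U,0) \to (X,x)$ to $T_0(U)$ and a germ $f$ to its derivative at $0$. The class of $u \in T_0(U)$ at $p$ is written $p_*(u)$. A smooth map $f : X \to Y$ induces a linear map $f_* : T_x(X) \to T_{f(x)}(Y)$ with $f_*(p_*(u)) = (f\circ p)_*(u)$. Let $TX = \coprod_{x \in X} T_x(X)$ with projection to $X$. For a plot $p : U \to X$, let $Tp : TU \to TX$ send $v \in T_u U$ to the element of $T_{p(u)}(X)$ represented by $v$ at the pointed plot $w \mapsto p(u+w)$ (defined near $0$). $T^H X$ (Hector's diffeology) is $TX$ with the smallest diffeology making all $Tp$ smooth; its plots are the functions that locally are constant or of the form $Tp \circ f$ with $f : U' \to TU$ smooth. $T^{dvs} X$ is $TX$ with the smallest diffeology containing Hector's diffeology and making $TX$ a diffeological vector space over $X$, i.e. such that the projection to $X$, the fiberwise addition $TX \times_X TX \to TX$ and the scalar multiplication $TX \times \mathbb{R} \to TX$ are smooth. $T_x^H(X)$ and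 $T_x^{dvs}(X)$ denote the fiber $T_x(X)$ with the sub-diffeology from $T^H X$ and $T^{dvs}X$ respectively. *)

(* Defs.v *)
From HB Require Import structures.
From mathcomp Require Import all_boot all_order all_algebra generic_quotient.
From mathcomp Require Import boolp classical_sets functions reals topology normedtype.
From mathcomp Require Import landau derive.

Set Implicit Arguments.
Unset Strict Implicit.
Unset Printing Implicit Defensive.
Import Order.TTheory GRing.Theory Num.Theory.
Import numFieldNormedType.Exports.
Local Open Scope ring_scope.
Local Open Scope classical_set_scope.
Local Open Scope quotient_scope.

(* [f] is C^k on the open set [U], in terms of iterated directional derivatives
   (used for finite-dimensional [V] and open [U] only).  *)
Fixpoint Ck (R : realType) (V W : normedModType R) (k : nat) (U : set V)
    (f : V -> W) : Prop :=
  if k is k'.+1 then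
    (forall x, U x -> differentiable f x) /\ forall v : V, Ck k' U ('D_v f)
  else forall x, U x -> {for x, continuous f}.

Definition smooth_on (R : realType) (V W : normedModType R) (U : set V)
  (f : V -> W) := forall k, Ck k U f.

Section Ck_theory.
Context {R : realType}.
Implicit Types V W : normedModType R.

Lemma diff_near V W (f g : V -> W) x : {near x, f =1 g} ->
  differentiable f x -> differentiable g x.
Proof.
move=> fg df.
have fgx : g x = f x by rewrite (nbhs_singleton fg).
apply/diff_locallyP.
have [dc dl] := (diff_locallyP _ _).1 df.
have E : g \o shift x = cst (g x) + 'd f x +o_ (0 : V) id.
  apply/eqaddoP => e e0.
  have /eqaddoP/(_ _ e0) := dl.
  apply: filterS2; last first.
    rewrite (near_shift 0 x) in fg. exact: fg.
  move=> y /=; rewrite !subr0 => {}E; rewrite !fctE /= in E *.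
  by rewrite E fgx.
have := diff_unique dc E.
by move=> ->.
Qed.

Lemma near_open V (U : set V) (P : V -> Prop) x :
  open U -> U x -> (forall y, U y -> P y) -> \forall y \near x, P y.
Proof. by move=> oU Ux UP; apply: filterS (open_nbhs_nbhs (conj oU Ux)). Qed.

Lemma Ck_ext V W k (U : set V) (f g : V -> W) : open U ->
  (forall x, U x -> f x = g x) -> Ck k U f -> Ck k U g.
Proof.
move=> oU; elim: k f g => [|k IH] f g fg /=.
  move=> fc x Ux; change (g @ x --> g x); rewrite -(fg _ Ux).
  apply: cvg_trans (fc x Ux); apply: near_eq_cvg.
  exact: near_open Ux fg.
move=> [fd fD]; split=> [x Ux|v].
  by apply: diff_near (fd x Ux); exact: near_open Ux fg.
apply: IH (fD v) => x Ux; apply: near_eq_derive; exact: near_open Ux fg.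
Qed.

Lemma CkW V W k (U : set V) (f : V -> W) : Ck k.+1 U f -> Ck k U f.
Proof.
elim: k f => [|k IH] f /=; first by case=> fd _ x /fd; exact: differentiable_continuous.
by case=> fd fD; split=> // v; apply: IH.
Qed.

Lemma Ck_sub V W k (U U' : set V) (f : V -> W) : U' `<=` U -> Ck k U f -> Ck k U' f.
Proof.
move=> UU'; elim: k f => [|k IH] f /=; first by move=> fc x /UU'; exact: fc.
by case=> fd fD; split=> [x /UU'|v]; [exact: fd|exact: IH].
Qed.

Lemma Ck_local V W k (U : set V) (f : V -> W) :
  (forall x, U x -> exists U', [/\ open U', U' x, U' `<=` U & Ck k U' f]) -> Ck k U f.
Proof.
elim: k f => [|k IH] f /= H.
  by move=> x /H[U' [_ U'x _]]; apply.
split=> [x /H[U' [_ U'x _ []]]|v]; first by move=> + _; apply.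
apply: IH => x /H[U' [? ? ? [_ fD]]]; by exists U'.
Qed.

Lemma Ck_cst V W k (U : set V) (c : W) : Ck k U (cst c : V -> W).
Proof.
elim: k c => [|k IH] c /=; first by move=> x _; exact: cst_continuous.
split=> [x _|v]; first exact: differentiable_cst.
rewrite [X in Ck _ _ X](_ : _ = cst 0) //.
by apply/funext => x; rewrite derive_cst.
Qed.

Lemma CkD V W k (U : set V) (f g : V -> W) : open U ->
  Ck k U f -> Ck k U g -> Ck k U (fun x => f x + g x).
Proof.
move=> oU; elim: k f g => [|k IH] f g /=.
  by move=> fc gc x Ux; apply: continuousD; [exact: fc|exact: gc].
move=> [fd fD] [gd gD]; split=> [x Ux|v].
  by apply: (@differentiableD _ _ _ f g); [exact: fd|exact: gd].
apply: Ck_ext (IH _ _ (fD v) (gD v)) => // x Ux.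
by rewrite (@deriveD _ _ _ f g) //; apply: diff_derivable; [exact: fd|exact: gd].
Qed.

Lemma Ck_sum V W k (U : set V) n (f : 'I_n -> V -> W) : open U ->
  (forall i, Ck k U (f i)) -> Ck k U (fun x => \sum_i f i x).
Proof.
move=> oU; elim: n f => [|n IH] f fC.
  rewrite [X in Ck _ _ X](_ : _ = cst 0); first exact: Ck_cst.
  by apply/funext => x; rewrite big_ord0.
rewrite [X in Ck _ _ X](_ : _ =
  fun x => (\sum_(i < n) f (widen_ord (leqnSn n) i) x) + f ord_max x).
  by apply: CkD => //; exact: IH.
by apply/funext => x; rewrite big_ord_recr.
Qed.

Definition scale2 W (a : R^o) (w : W) : W := a *: w.

Lemma scale_is_bilinear W :
  bilinear_for
    (GRing.Scale.Law.clone _ _ *:%R _) (GRing.Scale.Law.clone _ _ *:%R _)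
    (@scale2 W).
Proof.
rewrite /scale2; split=> [u'|u] a x y /=; first by rewrite scalerDl scalerA.
by rewrite scalerDr !scalerA mulrC.
Qed.
HB.instance Definition _ W := bilinear_isBilinear.Build R R^o W W _ _
  (@scale2 W) (@scale_is_bilinear W).

Lemma dscale2 V W (h : V -> R^o) (g : V -> W) x :
  differentiable h x -> differentiable g x ->
  differentiable (fun y => h y *: g y) x /\
  forall v, 'd (fun y => h y *: g y) x v = h x *: 'd g x v + 'd h x v *: g x.
Proof.
move=> dh dg.
pose B := [the {bilinear R^o -> W -> W} of @scale2 W].
have Bc : continuous (fun p : R^o * W => B p.1 p.2) by exact: scale_continuous.
have dB := @differentiable_bilin R R^o W W B (h x, g x) Bc.
have dp : differentiable (fun y => (h y, g y)) x by exact: differentiable_pair.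
split; first exact: (@differentiable_comp _ _ _ _ (fun y => (h y, g y))
  (fun p => B p.1 p.2) x dp dB).
move=> v.
rewrite [LHS](_ : _ = 'd ((fun p => B p.1 p.2) \o (fun y => (h y, g y))) x v)//.
rewrite diff_comp //= diff_pair // diff_bilin //.
Qed.

Lemma CkZ V W k (U : set V) (h : V -> R^o) (g : V -> W) : open U ->
  Ck k U h -> Ck k U g -> Ck k U (fun x => h x *: g x).
Proof.
move=> oU; elim: k W h g => [|k IH] W h g.
  by move=> hc gc x Ux; apply: continuousZ; [exact: hc|exact: gc].
move=> hC gC; have [hd hD] := hC; have [gd gD] := gC; split=> [x Ux|v].
  by case: (dscale2 (hd x Ux) (gd x Ux)).
apply: (@Ck_ext _ _ _ _ (fun x => h x *: 'D_v g x + 'D_v h x *: g x)) => // [x Ux|].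
  have [d E] := dscale2 (hd x Ux) (gd x Ux).
  rewrite !deriveE ?E //; try exact: gd; try exact: hd.
by apply: CkD => //; apply: IH; [exact: CkW|exact: gD|exact: hD|exact: CkW].
Qed.

Lemma Ck_lin V W W' k (U : set V) (L : {linear W -> W'}) (f : V -> W) :
  open U -> continuous L -> Ck k U f -> Ck k U (fun x => L (f x)).
Proof.
move=> oU Lc; elim: k f => [|k IH] f.
  by move=> fc x Ux; apply: continuous_comp; [exact: fc|exact: Lc].
move=> [fd fD]; have dL x := linear_differentiable x Lc.
split=> [x Ux|v].
  by apply: (@differentiable_comp _ _ _ _ f L) => //; exact: fd.
apply: Ck_ext (IH _ (fD v)) => // x Ux.
have dfx := fd _ Ux.
have dLf : differentiable (fun y => L (f y)) x by exact: (@differentiable_comp _ _ _ _ f L).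
rewrite [RHS]deriveE // deriveE // [in RHS](_ : (fun _ => _) = L \o f) //.
by rewrite (diff_comp dfx (dL _)) /= (diff_lin _ Lc).
Qed.

Lemma Ck_comp V n W k (U1 : set V) (U2 : set 'rV[R]_n)
    (f : V -> 'rV[R]_n) (g : 'rV[R]_n -> W) :
  open U1 -> (forall x, U1 x -> U2 (f x)) ->
  Ck k U1 f -> Ck k U2 g -> Ck k U1 (fun x => g (f x)).
Proof.
move=> oU fU; elim: k W g => [|k IH] W g.
  by move=> fc gc x Ux; apply: continuous_comp; [exact: fc|exact/gc/fU].
move=> fC gC; have [fd fD] := fC; have [gd gD] := gC.
have dgf x : U1 x -> differentiable (fun x => g (f x)) x.
  move=> Ux; apply: (@differentiable_comp _ _ _ _ f g); [exact: fd|exact/gd/fU].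
split=> // v.
apply: (@Ck_ext _ _ _ _ (fun x => \sum_(j < n)
  ('D_v f x 0 j : R^o) *: 'D_(delta_mx 0 j) g (f x))) => // [x Ux|].
  have dgx := gd _ (fU _ Ux); have dfx := fd _ Ux.
  rewrite [RHS]deriveE; last exact: dgf.
  have -> : 'd (fun y => g (f y)) x v = 'd g (f x) ('D_v f x).
    by rewrite (diff_comp dfx dgx) /= deriveE.
  rewrite [in RHS](row_sum_delta ('D_v f x)) linear_sum /=.
  by apply: eq_bigr => j _; rewrite linearZ /=; congr (_ *: _); exact: deriveE.
apply: Ck_sum => // j; apply: CkZ => //.
  have @L : {linear 'rV[R]_n -> R^o}.
    by exists (fun N : 'rV[R]_n => N 0 j : R^o); do 2![eexists]; do ?[constructor];
       rewrite ?mxE// => ? *; rewrite ?mxE//; move=> ?; rewrite !mxE.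
  by apply: (@Ck_lin _ _ R^o _ _ L) => //; [move=> x; exact: coord_continuous|exact: fD].
by apply: (IH _ (fun y => 'D_(delta_mx 0 j) g y)); [exact: CkW|exact: gD].
Qed.

Lemma Ck_id V k (U : set V) : Ck k U (id : V -> V).
Proof.
case: k => [|k] /=; first by move=> x _; exact: cvg_id.
split=> [x _|v]; first exact: ex_diff.
rewrite [X in Ck _ _ X](_ : _ = cst v); first exact: Ck_cst.
by apply/funext => x; rewrite derive_id.
Qed.

End Ck_theory.

(* A function on an open set [U] of ['rV_n] is represented by a total function
   considered on [U] only: [plotd_ext] says that its values outside [U] are
   irrelevant.  In [plotd_local] the [V]'s form an open cover of [U].  *)
Record diffeology (R : realType) (T : Type) := Diffeology {
  plotd : forall n, set 'rV[R]_n -> ('rV[R]_n -> T) -> Prop ;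
  plotd_open : forall n (U : set 'rV[R]_n) p, plotd U p -> open U ;
  plotd_ext : forall n (U : set 'rV[R]_n) p q,
    (forall u, U u -> p u = q u) -> plotd U p -> plotd U q ;
  plotd_cst : forall n (U : set 'rV[R]_n) x, open U -> plotd U (cst x) ;
  plotd_comp : forall m n (V : set 'rV[R]_m) (U : set 'rV[R]_n) f p,
    open V -> smooth_on V f -> (forall v, V v -> U (f v)) -> plotd U p ->
    plotd V (p \o f) ;
  plotd_local : forall n (U : set 'rV[R]_n) p, open U ->
    (forall u, U u -> exists V, [/\ open V, V u, V `<=` U & plotd V p]) ->
    plotd U p }.

Record diffSpace (R : realType) := DiffSpace {
  carrier :> Type ;
  diffeo : diffeology R carrier }.

Definition plot (R : realType) (X : diffSpace R) n (U : set 'rV[R]_n)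
  (p : 'rV[R]_n -> X) := plotd (diffeo X) U p.

Definition smooth (R : realType) (X Y : diffSpace R) (f : X -> Y) :=
  forall n (U : set 'rV[R]_n) (p : 'rV[R]_n -> X), plot U p -> plot U (f \o p).

Record smoothMap (R : realType) (X Y : diffSpace R) := SmoothMap {
  smfun :> X -> Y ;
  smfunP : smooth smfun }.

Definition diffeomorphism (R : realType) (X Y : diffSpace R) (f : X -> Y) :=
  smooth f /\
  exists g : Y -> X, [/\ smooth g, cancel f g & cancel g f].

Definition subduction (R : realType) (X Y : diffSpace R) (f : X -> Y) :=
  [/\ smooth f, range f = [set: Y] &
    forall n (U : set 'rV[R]_n) (p : 'rV[R]_n -> Y), open U ->
      (plot U p <->
       forall u, U u -> exists V (q : 'rV[R]_n -> X),
         [/\ open V, V u, V `<=` U, plot V q & forall v, V v -> f (q v) = p v])].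

Section constructions.
Context {R : realType}.
Implicit Types X Y : diffSpace R.

Section euclid.
Variable W : normedModType R.
Let plotW n (U : set 'rV[R]_n) (p : 'rV[R]_n -> W) := open U /\ smooth_on U p.

Lemma euclid_ext n (U : set 'rV[R]_n) (p q : 'rV[R]_n -> W) :
  (forall u, U u -> p u = q u) -> plotW U p -> plotW U q.
Proof. by move=> pq [oU sp]; split=> // k; exact: Ck_ext (sp k). Qed.

Lemma euclid_cst n (U : set 'rV[R]_n) (x : W) : open U -> plotW U (cst x).
Proof. by move=> oU; split=> // k; exact: Ck_cst. Qed.

Lemma euclid_comp m n (V : set 'rV[R]_m) (U : set 'rV[R]_n) f (p : _ -> W) :
  open V -> smooth_on V f -> (forall v, V v -> U (f v)) -> plotW U p ->
  plotW V (p \o f).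
Proof. by move=> oV sf fVU [oU sp]; split=> // k; exact: Ck_comp (sf k) (sp k). Qed.

Lemma euclid_local n (U : set 'rV[R]_n) (p : 'rV[R]_n -> W) : open U ->
  (forall u, U u -> exists V, [/\ open V, V u, V `<=` U & plotW V p]) ->
  plotW U p.
Proof.
move=> oU H; split=> // k; apply: Ck_local => x /H[V [? ? ? [_ pV]]].
by exists V; split=> //; exact: pV.
Qed.

Definition euclid := DiffSpace (Diffeology (fun n U p (h : @plotW n U p) => h.1)
  euclid_ext euclid_cst euclid_comp euclid_local).
End euclid.

Section pullback_diffeology.
Variables (T : Type) (Y : diffSpace R) (f : T -> Y).
Let plotT n (U : set 'rV[R]_n) (p : 'rV[R]_n -> T) := plot U (f \o p).

Definition induced_diffeology : diffeology R T.
Proof.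
apply: (@Diffeology _ _ plotT).
- by move=> n U p; exact: plotd_open.
- by move=> n U p q pq; apply: plotd_ext => u Uu /=; rewrite pq.
- by move=> n U x oU; exact: (@plotd_cst _ _ (diffeo Y) n U (f x)).
- by move=> m n V U g p oV sg gVU; exact: plotd_comp.
- by move=> n U p oU H; apply: plotd_local.
Defined.
End pullback_diffeology.

Definition subdiff X (A : set X) : diffSpace R :=
  DiffSpace (induced_diffeology (@sval X A)).

Definition prod_diffeology X Y : diffeology R (X * Y).
Proof.
apply: (@Diffeology _ _ (fun n U p => plot U (fst \o p) /\ plot U (snd \o p))).
- by move=> n U p [+ _]; exact: plotd_open.
- move=> n U p q pq [p1 p2].
  by split; [move: p1|move: p2]; apply: plotd_ext => u Uu /=; rewrite pq.
- by move=> n U x oU; split; exact: plotd_cst.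
- by move=> m n V U f p oV sf fVU [p1 p2]; split;
    [exact: plotd_comp p1|exact: plotd_comp p2].
- by move=> n U p oU H; split; apply: plotd_local => // u /H[V [? ? ? []]];
    exists V.
Defined.

Definition prod_space X Y : diffSpace R := DiffSpace (prod_diffeology X Y).

Definition pullback X Y (Z : diffSpace R) (f : X -> Z) (g : Y -> Z) : diffSpace R :=
  subdiff [set xy : prod_space X Y | f xy.1 = g xy.2].

Section smallest.
Variables (T : Type) (P : diffeology R T -> Prop).

(* The intersection of all diffeologies satisfying [P].  *)
Definition smallest_diffeology : diffeology R T.
Proof.
apply: (@Diffeology _ _ (fun n U p => open U /\ forall D, P D -> plotd D U p)).
- by move=> n U p [].
- move=> n U p q pq [oU pU]; split=> // D PD; exact: plotd_ext (pU D PD).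
- by move=> n U x oU; split=> // D _; exact: plotd_cst.
- move=> m n V U f p oV sf fVU [_ pU]; split=> // D PD.
  exact: plotd_comp (pU D PD).
- move=> n U p oU H; split=> // D PD; apply: plotd_local => // u /H.
  by move=> [V [? ? ? [_ pV]]]; exists V; split=> //; exact: pV.
Defined.
End smallest.
End constructions.


Lemma open_component (R : realType) (V : normedModType R) (U : set V) x :
  open U -> open (connected_component U x).
Proof.
move=> oU; rewrite openE => y Cy.
have Uy : U y := connected_component_sub Cy.
have /nbhs_ballP[e /= e0 yeU] : nbhs y U by exact: open_nbhs_nbhs.
apply/nbhs_ballP; exists e => //= z yez.
apply: connected_component_trans Cy _.
pose g (t : R) : V := y + t *: (z - y).
apply: (@connected_component_max _ _ (g @` `[0, 1])).
- by exists 0; rewrite /= ?in_itv /= ?lexx ?ler01 // /g scale0r addr0.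
- move=> _ [t /= /[!in_itv] /= /andP[t0 t1] <-]; apply: yeU.
  rewrite -ball_normE /= /g opprD addNKr normrN normrZ ger0_norm //.
  move: yez; rewrite -ball_normE /= distrC; apply: le_lt_trans.
  by rewrite ler_piMl.
- apply: connected_continuous_connected; first exact: segment_connected.
  apply: continuous_subspaceT => t.
  rewrite /continuous_at /g; apply: cvgD; first exact: cvg_cst.
  by apply: cvgZr_tmp; exact: cvg_id.
- by exists 1; rewrite /= ?in_itv /= ?lexx ?ler01 // /g scale1r addrC subrK.
Qed.

Section tangent.
Context {R : realType}.
Implicit Types X Y : diffSpace R.

(* [T_0(U)] is ['rV_n] for [U] open in ['rV_n].  *)
Record pplot X (x : X) := PPlot {
  pdim : nat ;
  pdom : set 'rV[R]_pdim ;
  pmap :> 'rV[R]_pdim -> X ;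
  pplotP : plot pdom pmap ;
  pplot_connected : connected pdom ;
  pplot_dom0 : pdom 0 ;
  pplot0 : pmap 0 = x }.

Arguments pdom {X x} p.

(* The germ of [f] at [0] is a morphism from [p] to [q].  The colimit below only
   sees the derivative at [0], which depends on that germ only.  *)
Definition germ_mor X (x : X) (p q : pplot x)
    (f : 'rV[R]_(pdim p) -> 'rV[R]_(pdim q)) : Prop :=
  exists W : set 'rV[R]_(pdim p),
    [/\ open W, W 0 & W `<=` pdom p] /\
    [/\ smooth_on W f, (forall w, W w -> pdom q (f w)), f 0 = 0 &
        forall w, W w -> p w = q (f w)].

(* Presentation of the colimit in vector spaces: formal linear expressions in
   the generators [p_*(u)] modulo the congruence [trel] generated by the vector
   space axioms, the linearity of each [p_*], and [p_*(u) = q_*('d f 0 u)].  *)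
Inductive tterm X (x : X) : Type :=
| TZero
| TOpp of tterm x
| TAdd of tterm x & tterm x
| TScale of R & tterm x
| TVec (p : pplot x) of 'rV[R]_(pdim p).

Inductive trel X (x : X) : tterm x -> tterm x -> Prop :=
| trel_refl t : trel t t
| trel_sym s t : trel s t -> trel t s
| trel_trans s t r : trel s t -> trel t r -> trel s r
| trel_opp s t : trel s t -> trel (TOpp s) (TOpp t)
| trel_add s s' t t' : trel s s' -> trel t t' -> trel (TAdd s t) (TAdd s' t')
| trel_scale a s t : trel s t -> trel (TScale a s) (TScale a t)
| trel_addA s t r : trel (TAdd s (TAdd t r)) (TAdd (TAdd s t) r)
| trel_addC s t : trel (TAdd s t) (TAdd t s)
| trel_add0 t : trel (TAdd (TZero x) t) t
| trel_addN t : trel (TAdd (TOpp t) t) (TZero x)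
| trel_scaleA a b t : trel (TScale a (TScale b t)) (TScale (a * b) t)
| trel_scale1 t : trel (TScale 1 t) t
| trel_scaleDr a s t : trel (TScale a (TAdd s t)) (TAdd (TScale a s) (TScale a t))
| trel_scaleDl a b t : trel (TScale (a + b) t) (TAdd (TScale a t) (TScale b t))
| trel_vecD p (u v : 'rV[R]_(pdim p)) :
    trel (TVec (u + v)) (TAdd (TVec u) (TVec v))
| trel_vecZ p a (u : 'rV[R]_(pdim p)) : trel (TVec (a *: u)) (TScale a (TVec u))
| trel_germ p q (f : 'rV[R]_(pdim p) -> 'rV[R]_(pdim q)) u :
    germ_mor f -> trel (TVec u) (TVec ('d f 0 u)).

HB.instance Definition _ X (x : X) := gen_eqMixin (tterm x).
HB.instance Definition _ X (x : X) := gen_choiceMixin (tterm x).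

Definition trelb X (x : X) : rel (tterm x) := fun s t => `[< trel s t >].

Lemma trelb_equiv X (x : X) : equiv_class_of (@trelb X x).
Proof.
split=> [t|s t|t s r]; first by apply/asboolP; exact: trel_refl.
  by apply/asboolP/asboolP; exact: trel_sym.
by move=> /asboolP st /asboolP tr; apply/asboolP; exact: trel_trans tr.
Qed.

Canonical trel_equiv X (x : X) := EquivRelPack (@trelb_equiv X x).

Definition tangent X (x : X) := {eq_quot (@trel_equiv X x)}.
HB.instance Definition _ X (x : X) := Choice.on (tangent x).

Definition tclass X (x : X) (t : tterm x) : tangent x := \pi_(tangent x) t.

Lemma tclassP X (x : X) (s t : tterm x) : tclass s = tclass t <-> trel s t.
Proof.
split=> [/eqmodP|st]; first by move/asboolP.
by apply/eqmodP/asboolP.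
Qed.

Lemma tclass_repr X (x : X) (t : tangent x) : tclass (repr t) = t.
Proof. exact: reprK. Qed.

Lemma repr_tclass X (x : X) (t : tterm x) : trel (repr (tclass t)) t.
Proof. by apply/tclassP; rewrite tclass_repr. Qed.

Section lmodule.
Variables (X : diffSpace R) (x : X).
Implicit Types s t r : tangent x.

Definition tan0 : tangent x := tclass (TZero x).
Definition tanN t : tangent x := tclass (TOpp (repr t)).
Definition tanD s t : tangent x := tclass (TAdd (repr s) (repr t)).
Definition tanZ (a : R) t : tangent x := tclass (TScale a (repr t)).

Lemma tanNE (t : tterm x) : tanN (tclass t) = tclass (TOpp t).
Proof. by apply/tclassP/trel_opp/repr_tclass. Qed.
Lemma tanDE (s t : tterm x) : tanD (tclass s) (tclass t) = tclass (TAdd s t).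
Proof. by apply/tclassP/trel_add; exact: repr_tclass. Qed.
Lemma tanZE a (t : tterm x) : tanZ a (tclass t) = tclass (TScale a t).
Proof. by apply/tclassP/trel_scale/repr_tclass. Qed.

Lemma tanDA : associative tanD.
Proof.
move=> s t r; rewrite -(tclass_repr s) -(tclass_repr t) -(tclass_repr r) !tanDE.
exact/tclassP/trel_addA.
Qed.
Lemma tanDC : commutative tanD.
Proof. by move=> s t; apply/tclassP/trel_addC. Qed.
Lemma tan0D : left_id tan0 tanD.
Proof.
by move=> t; rewrite -(tclass_repr t) tanDE; exact/tclassP/trel_add0.
Qed.
Lemma tanND : left_inverse tan0 tanN tanD.
Proof.
by move=> t; rewrite -(tclass_repr t) tanNE tanDE; exact/tclassP/trel_addN.
Qed.
HB.instance Definition _ := GRing.isZmodule.Build (tangent x) tanDA tanDC tan0D tanND.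

Lemma tanZA a b t : tanZ a (tanZ b t) = tanZ (a * b) t.
Proof. by rewrite -(tclass_repr t) !tanZE; exact/tclassP/trel_scaleA. Qed.
Lemma tan1Z : left_id 1 tanZ.
Proof. by move=> t; rewrite -(tclass_repr t) tanZE; exact/tclassP/trel_scale1. Qed.
Lemma tanZDr : right_distributive tanZ +%R.
Proof.
move=> a s t; rewrite -(tclass_repr s) -(tclass_repr t) [_ + _]tanDE !tanZE.
by rewrite [RHS]tanDE; exact/tclassP/trel_scaleDr.
Qed.
Lemma tanZDl t : {morph tanZ^~ t : a b / a + b}.
Proof.
move=> a b; rewrite -(tclass_repr t) !tanZE.
by rewrite [RHS]tanDE; exact/tclassP/trel_scaleDl.
Qed.
HB.instance Definition _ :=
  GRing.Zmodule_isLmodule.Build R (tangent x) tanZA tan1Z tanZDr tanZDl.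

(* The class [p_*(u)] *)
Definition tvec (p : pplot x) (u : 'rV[R]_(pdim p)) : tangent x :=
  tclass (TVec u).

Lemma tvec_is_linear p : linear (@tvec p).
Proof.
move=> a u v; rewrite -[RHS]/(tanD (tanZ a (tvec u)) (tvec v)) tanZE tanDE.
apply/tclassP.
apply: trel_trans (trel_vecD _ _) _.
by apply: trel_add; [exact: trel_vecZ|exact: trel_refl].
Qed.
HB.instance Definition _ p :=
  GRing.isLinear.Build R 'rV[R]_(pdim p) (tangent x) _ (@tvec p) (@tvec_is_linear p).

Lemma tvec_germ (p q : pplot x) (f : 'rV[R]_(pdim p) -> 'rV[R]_(pdim q)) u :
  germ_mor f -> tvec u = tvec ('d f 0 u).
Proof. by move=> fg; exact/tclassP/trel_germ. Qed.

Fixpoint teval (V : lmodType R) (L : forall p : pplot x, 'rV[R]_(pdim p) -> V)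
    (t : tterm x) : V :=
  match t with
  | TZero => 0
  | TOpp t => - teval L t
  | TAdd s t => teval L s + teval L t
  | TScale a t => a *: teval L t
  | TVec p u => L p u
  end.

Lemma teval_trel (V : lmodType R) (L : forall p : pplot x, {linear 'rV[R]_(pdim p) -> V}) :
  (forall p q (f : 'rV[R]_(pdim p) -> 'rV[R]_(pdim q)) u,
    germ_mor f -> L p u = L q ('d f 0 u)) ->
  forall s t : tterm x, trel s t -> teval (fun p => L p) s = teval (fun p => L p) t.
Proof.
move=> Lf s t; elim=> {s t} //=.
- by move=> s t r _ -> _ ->.
- by move=> s t _ ->.
- by move=> s s' t t' _ -> _ ->.
- by move=> a s t _ ->.
- by move=> s t r; rewrite addrA.
- by move=> s t; rewrite addrC.
- by move=> t; rewrite add0r.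
- by move=> t; rewrite addNr.
- by move=> a b t; rewrite scalerA.
- by move=> t; rewrite scale1r.
- by move=> a s t; rewrite scalerDr.
- by move=> a b t; rewrite scalerDl.
- by move=> p u v; rewrite linearD.
- by move=> p a u; rewrite linearZ.
Qed.

(* [tangent x] with the maps [tvec] is the colimit of [T_0] over pointed plots.  *)
Lemma tangent_universal (V : lmodType R)
    (L : forall p : pplot x, {linear 'rV[R]_(pdim p) -> V}) :
  (forall p q (f : 'rV[R]_(pdim p) -> 'rV[R]_(pdim q)) u,
    germ_mor f -> L p u = L q ('d f 0 u)) ->
  exists2 h : {linear tangent x -> V}, forall p u, h (@tvec p u) = L p u &
    forall g : {linear tangent x -> V}, (forall p u, g (@tvec p u) = L p u) -> g =1 h.
Proof.
move=> Lf; pose h (t : tangent x) := teval (fun p => L p) (repr t).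
have hE (t : tterm x) : h (tclass t) = teval (fun p => L p) t.
  exact/(teval_trel Lf)/repr_tclass.
have hlin : linear h.
  move=> a s t; rewrite -(tclass_repr s) -(tclass_repr t).
  rewrite -[_ + _]/(tanD (tanZ a (tclass _)) (tclass _)) tanZE tanDE.
  by rewrite !hE.
pose hM := GRing.isLinear.Build R (tangent x) V _ h hlin.
pose H : {linear tangent x -> V} := HB.pack h hM.
exists H => [p u|g gE t0]; first exact: hE.
suff gh (t : tterm x) : g (tclass t) = h (tclass t).
  by rewrite -(tclass_repr t0) gh.
rewrite hE; elim: t => [|t IH|s IHs t IHt|a t IH|p u] /=.
- exact: (linear0 g).
- by rewrite -IH -(linearN g) -tanNE.
- by rewrite -IHs -IHt -(linearD g) -tanDE.
- by rewrite -IH -(linearZ_LR g) -tanZE.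
- exact: gE.
Qed.

End lmodule.
End tangent.

Section tangent_map.
Context {R : realType}.
Implicit Types X Y : diffSpace R.

Definition push_pplot X Y (f : smoothMap X Y) (x : X) (p : pplot x) : pplot (f x) :=
  PPlot (smfunP f (pplotP p)) (@pplot_connected _ _ _ p) (pplot_dom0 p)
    (congr1 f (pplot0 p)).

Lemma push_germ X Y (f : smoothMap X Y) (x : X) (p q : pplot x)
    (g : 'rV[R]_(pdim p) -> 'rV[R]_(pdim q)) u :
  germ_mor g ->
  tvec (p := push_pplot f p) u = tvec (p := push_pplot f q) ('d g 0 u).
Proof.
move=> [W [[oW W0 Wp] [sg gW g0 pqg]]].
apply: (@tvec_germ _ _ _ (push_pplot f p) (push_pplot f q)); exists W.
by do 2!split=> //; move=> w Ww /=; rewrite pqg.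
Qed.

Definition tangent_map X Y (f : smoothMap X Y) (x : X) (t : tangent x) :
    tangent (f x) :=
  teval (fun p => @tvec _ _ _ (push_pplot f p)) (repr t).

Lemma tangent_map_tclass X Y (f : smoothMap X Y) (x : X) (t : tterm x) :
  tangent_map f (tclass t) = teval (fun p => @tvec _ _ _ (push_pplot f p)) t.
Proof.
pose L (p : pplot x) : {linear 'rV[R]_(pdim p) -> tangent (f x)} :=
  (@tvec R Y (f x) (push_pplot f p) :
     {linear 'rV[R]_(pdim (push_pplot f p)) -> tangent (f x)}).
have LP p q (g : 'rV[R]_(pdim p) -> 'rV[R]_(pdim q)) u :
  germ_mor g -> L p u = L q ('d g 0 u) by exact: push_germ.
exact: (teval_trel LP (repr_tclass t)).
Qed.

Lemma tangent_map_is_linear X Y (f : smoothMap X Y) (x : X) :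
  linear (@tangent_map X Y f x).
Proof.
move=> a s t; rewrite -(tclass_repr s) -(tclass_repr t).
rewrite -[_ + _]/(tanD (tanZ a (tclass _)) (tclass _)) tanZE tanDE.
by rewrite !tangent_map_tclass.
Qed.
HB.instance Definition _ X Y (f : smoothMap X Y) (x : X) :=
  GRing.isLinear.Build R (tangent x) (tangent (f x)) _ (@tangent_map X Y f x)
    (@tangent_map_is_linear X Y f x).

Lemma tangent_map_tvec X Y (f : smoothMap X Y) (x : X) (p : pplot x) u :
  tangent_map f (tvec u : tangent x) = tvec (p := push_pplot f p) u.
Proof. exact: tangent_map_tclass. Qed.

Definition tangent_bundle X := {x : X & tangent x}.

Definition open_domain n (U : set 'rV[R]_n) : diffSpace R :=
  subdiff (X := euclid 'rV[R]_n) U.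

Definition tangent_domain n (U : set 'rV[R]_n) : diffSpace R :=
  prod_space (open_domain U) (euclid 'rV[R]_n).

Section shift.
Variables (X : diffSpace R) (n : nat) (U : set 'rV[R]_n) (p : 'rV[R]_n -> X).
Variables (pU : plot U p) (u : 'rV[R]_n) (Uu : U u).

Let V : set 'rV[R]_n := connected_component [set w | U (u + w)] 0.

Let open_V : open V.
Proof.
apply: open_component.
have cu : continuous (fun w : 'rV[R]_n => u + w).
  by move=> w; apply: (@continuousD _ _ _ (cst u) id w); [exact: cst_continuous|exact: cvg_id].
exact: (open_comp (fun w _ => cu w) (plotd_open pU)).
Qed.

Lemma shift_plot : plot V (fun w => p (u + w)).
Proof.
have su : smooth_on V (fun w : 'rV[R]_n => u + w).
  by move=> k; apply: (@CkD _ _ _ _ _ (cst u) id open_V); [exact: Ck_cst|exact: Ck_id].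
by apply: (plotd_comp open_V su _ pU) => w /connected_component_sub.
Qed.

Lemma shift_dom0 : V 0.
Proof. by apply: connected_component_refl; rewrite /= addr0. Qed.

Lemma shift_base : p (u + 0) = p u.
Proof. by rewrite addr0. Qed.

(* The pointed plot [w |-> p (u + w)], on the connected component of [0] of its
   natural domain since pointed plots have connected domains.  *)
Definition shift_pplot : pplot (p u) :=
  PPlot shift_plot (@component_connected _ _ _) shift_dom0 shift_base.
End shift.

Definition Tplot X n (U : set 'rV[R]_n) (p : 'rV[R]_n -> X) (pU : plot U p)
    (uv : tangent_domain U) : tangent_bundle X :=
  existT _ (p (sval uv.1)) (tvec (p := shift_pplot pU (svalP uv.1)) uv.2).

Definition is_hector X (D : diffeology R (tangent_bundle X)) : Prop :=
  forall n (U : set 'rV[R]_n) (p : 'rV[R]_n -> X) (pU : plot U p),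
    smooth (Y := DiffSpace D) (Tplot pU).

Definition THector X : diffSpace R :=
  DiffSpace (smallest_diffeology (@is_hector X)).

Definition tangent_cast X (x y : X) (xy : x = y) (t : tangent x) : tangent y :=
  ecast z (tangent z) xy t.

Definition Tproj X (t : tangent_bundle X) : X := projT1 t.

Definition Tadd X
    (st : {st : tangent_bundle X * tangent_bundle X | Tproj st.1 = Tproj st.2}) : tangent_bundle X :=
  existT _ (Tproj (sval st).1)
    (projT2 (sval st).1 + tangent_cast (esym (svalP st)) (projT2 (sval st).2)).

Definition Tscale X (ta : tangent_bundle X * R^o) : tangent_bundle X :=
  existT _ (Tproj ta.1) (ta.2 *: projT2 ta.1).

Definition is_dvs X (D : diffeology R (tangent_bundle X)) : Prop :=
  let TX := DiffSpace D in
  [/\ smooth (X := TX) (Y := X) (@Tproj X),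
      smooth (X := pullback (X := TX) (Y := TX) (Z := X) (@Tproj X) (@Tproj X))
        (Y := TX) (@Tadd X) &
      smooth (X := prod_space TX (euclid R^o)) (Y := TX) (@Tscale X)].

Definition Tdvs X : diffSpace R :=
  DiffSpace (smallest_diffeology (fun D : diffeology R (tangent_bundle X) =>
    (forall n (U : set 'rV[R]_n) q,
      plot (X := THector X) U q -> plotd D U q) /\ is_dvs D)).

(* The two intersections above do satisfy the conditions defining them.  *)
Lemma THector_is_hector X : is_hector (diffeo (THector X)).
Proof.
move=> n U p pU m V q pq; split=> [|D hD]; last exact: hD pq.
by case: pq => + _; exact: plotd_open.
Qed.

Lemma coarse_dvs X :
  let D := induced_diffeology (@Tproj X) in is_hector D /\ is_dvs D.
Proof.
split=> [n U p pU m V q [q1 q2]|].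
  case: q1 => oV sq.
  by apply: (plotd_comp oV sq _ pU) => v _; exact: (svalP (q v).1).
by split=> [n U q qU|n U q [q1 _]|n U q [q1 _]].
Qed.

Lemma Tdvs_is_dvs X :
  (forall n (U : set 'rV[R]_n) q, plot (X := THector X) U q -> plot (X := Tdvs X) U q)
  /\ is_dvs (diffeo (Tdvs X)).
Proof.
split.
  move=> n U q qU; split=> [|D [hD _]]; last exact: hD.
  exact: plotd_open qU.
split.
- move=> n U q [_ qU]; apply: (qU (induced_diffeology (@Tproj X))).
  have [hH hD] := coarse_dvs X; split=> // m V p [_ pV]; exact: pV.
- move=> n U q [q1 q2]; split=> [|D PD]; first exact: plotd_open q1.
  have [_ [_ + _]] := PD; apply.
  by split; [case: q1 => _; exact|case: q2 => _; exact].
- move=> n U q [q1 q2]; split=> [|D PD]; first exact: plotd_open q1.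
  have [_ [_ _ +]] := PD; apply.
  by split=> //; case: q1 => _; exact.
Qed.

Definition tangentH X (x : X) : diffSpace R :=
  DiffSpace (induced_diffeology (Y := THector X) (existT (@tangent R X) x)).

Definition tangent_dvs X (x : X) : diffSpace R :=
  DiffSpace (induced_diffeology (Y := Tdvs X) (existT (@tangent R X) x)).

Definition locally_trivial n (U : set 'rV[R]_n) (Z : diffSpace R)
    (g : Z -> open_domain U) (F : diffSpace R) : Prop :=
  exists C : set (set 'rV[R]_n),
    [/\ forall V, C V -> open V, \bigcup_(V in C) V = U &
        forall V, C V ->
          exists phi : subdiff [set z | V (sval (g z))] -> prod_space (open_domain V) F,
            diffeomorphism phi /\ forall z, sval (phi z).1 = sval (g (sval z))].

Definition bundle_with_fiber X Y (f : smoothMap X Y) (F : diffSpace R) : Prop :=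
  forall n (U : set 'rV[R]_n) (p : 'rV[R]_n -> Y), plot U p ->
    locally_trivial
      (fun z : pullback (X := open_domain U) (fun u => p (sval u)) f => (sval z).1)
      F.

Definition diffeological_bundle X Y (f : smoothMap X Y) : Prop :=
  exists F : diffSpace R, bundle_with_fiber f F.

Lemma sval_smooth X (A : set X) : smooth (X := subdiff A) (Y := X) (@sval X A).
Proof. by move=> n U p. Qed.

Definition inclusion X (A : set X) : smoothMap (subdiff A) X :=
  SmoothMap (@sval_smooth X A).

Definition fiber X Y (f : X -> Y) (y : Y) : set X := [set x | f x = y].

Definition exact_at (V1 V2 V3 : lmodType R)
    (f : {linear V1 -> V2}) (g : {linear V2 -> V3}) : Prop :=
  range f = [set v | g v = 0].

End tangent_map.

(* Main.v *)
Require Import Defs.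
From mathcomp Require Import all_boot all_order all_algebra.
From mathcomp Require Import boolp classical_sets functions reals topology normedtype.
From mathcomp Require Import derive.

(** All four claims come from local triviality, in the form of
    [local_trivialization]: near a point of its domain, a plot [p] of [B] comes
    with a smooth identification [Phi v] of a fixed space with the fiber of [pi]
    over [p v], with inverse [Psi v].

    Surjectivity: [v |-> Phi v (Psi 0 e)] is a section through [e] over a plot [p]
    pointed at [pi e], so every generator [p_*(u)] lifts.

    Exactness: call vertical the vectors that come from the fiber through [e].
    They are killed by the projection as [pi] is constant on the fiber. Conversely,
    a plot of [E] over [p] has the form [v |-> Phi v (sigma v)]; by linearity of
    the derivative on [(v, w) |-> Phi v (sigma w)] it represents the same vectors
    as the section above plus vertical ones ([vertical_section]). Hence lifting is
    well defined modulo vertical vectors and compatible with the relations of the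
    colimit. This makes it a right inverse of the projection modulo vertical
    vectors, and also a left inverse, whence [kernel_vertical].

    Subductions: the smallest diffeologies are first made explicit. Plots of
    Hector's diffeology are locally constant or [Tp \o (f, g)] ([plotHP]); plots of
    the vector space diffeology are locally finite fiberwise sums of such functions
    ([plotdvsP]). A plot of the first kind with values in the tangent space at
    [pi e] is lifted, with all values at the single point [e], by letting the
    section of [pi] depend on the parameter ([tangent_gen_lift]). Sums are lifted
    term by term, and constants by surjectivity. *)

Set Implicit Arguments.
Unset Strict Implicit.
Unset Printing Implicit Defensive.
Import Order.TTheory GRing.Theory Num.Theory.
Import numFieldNormedType.Exports.
Local Open Scope ring_scope.
Local Open Scope classical_set_scope.

(** * Smooth maps between Euclidean spaces *)

Section calculus.
Context {R : realType}.

Lemma linear_rV_continuous (W : normedModType R) n (L : {linear 'rV[R]_n -> W}) :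
  continuous L.
Proof.
have -> : (L : _ -> _) = fun v => \sum_j v 0 j *: L (delta_mx 0 j).
  apply/funext => v; rewrite {1}(row_sum_delta v) linear_sum /=.
  by apply: eq_bigr => j _; rewrite linearZ.
pose f j (v : 'rV[R]_n) := v 0 j *: L (delta_mx 0 j).
move=> v; have := @Ck_sum R _ W 0%N setT _ f openT.
apply=> // j {}v _.
by apply: continuousZ; [exact: coord_continuous|exact: cst_continuous].
Qed.

Lemma smooth_linear (W : normedModType R) n (U : set 'rV[R]_n)
    (L : {linear 'rV[R]_n -> W}) : open U -> smooth_on U L.
Proof.
move=> oU k; apply: (Ck_lin oU (@linear_rV_continuous _ _ L)); exact: Ck_id.
Qed.

Lemma smooth_row_mx (V : normedModType R) m n (U : set V)
    (f : V -> 'rV[R]_m) (g : V -> 'rV[R]_n) : open U ->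
  smooth_on U f -> smooth_on U g -> smooth_on U (fun v => row_mx (f v) (g v)).
Proof.
move=> oU sf sg k.
apply: (@Ck_ext _ _ _ _ _ (fun v => f v *m row_mx 1%:M 0 + g v *m row_mx 0 1%:M)) => //.
  by move=> x _; rewrite !mul_mx_row !mulmx1 !mulmx0 add_row_mx addr0 add0r.
apply: CkD => //; apply: (Ck_lin (L := mulmxr _)) => //; exact: linear_rV_continuous.
Qed.

Lemma diff_row_mx m n k (f : 'rV[R]_k -> 'rV[R]_m) (g : 'rV[R]_k -> 'rV[R]_n) x u :
  differentiable f x -> differentiable g x ->
  'd (fun v => row_mx (f v) (g v)) x u = row_mx ('d f x u) ('d g x u).
Proof.
move=> df dg.
pose A : {linear 'rV[R]_m -> 'rV[R]_(m + n)} := mulmxr (row_mx 1%:M 0).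
pose B : {linear 'rV[R]_n -> 'rV[R]_(m + n)} := mulmxr (row_mx 0 1%:M).
have cA := @linear_rV_continuous _ _ A; have cB := @linear_rV_continuous _ _ B.
have -> : (fun v => row_mx (f v) (g v)) = (A \o f) + (B \o g).
  apply/funext => v; rewrite fctE /= !mul_mx_row !mulmx1 !mulmx0.
  by rewrite add_row_mx addr0 add0r.
have dA := linear_differentiable (f x) cA; have dB := linear_differentiable (g x) cB.
have dAf : differentiable (A \o f) x by exact: differentiable_comp.
have dBg : differentiable (B \o g) x by exact: differentiable_comp.
have E1 : 'd (A \o f) x u = 'd A (f x) ('d f x u).
  exact: (congr1 (@^~ u) (diff_comp df dA)).
have E2 : 'd (B \o g) x u = 'd B (g x) ('d g x u).
  exact: (congr1 (@^~ u) (diff_comp dg dB)).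
have E3 : 'd A (f x) ('d f x u) = A ('d f x u).
  exact: (congr1 (@^~ _) (diff_lin (f x) cA)).
have E4 : 'd B (g x) ('d g x u) = B ('d g x u).
  exact: (congr1 (@^~ _) (diff_lin (g x) cB)).
rewrite (diffD dAf dBg); transitivity ('d (A \o f) x u + 'd (B \o g) x u) => //.
rewrite [X in X + _](etrans E1 E3) [X in _ + X](etrans E2 E4) /A /B /=.
by rewrite !mul_mx_row !mulmx1 !mulmx0 add_row_mx addr0 add0r.
Qed.

Lemma diff_id (V : normedModType R) (x v : V) : 'd id x v = v.
Proof. by have /(congr1 (@^~ v)) := @diff_val _ _ _ _ _ _ _ (is_diff_id x). Qed.

Lemma open_preimage (V W : normedModType R) (U : set V) (f : V -> W) (O : set W) :
  open U -> smooth_on U f -> open O -> open (U `&` f @^-1` O).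
Proof.
move=> oU sf oO; rewrite openE => x [Ux Ofx].
have := sf 0%N x Ux => fc.
apply: filterI; first exact: open_nbhs_nbhs.
by apply: fc; exact: open_nbhs_nbhs.
Qed.

Lemma smooth_cst (V W : normedModType R) (U : set V) (c : W) : smooth_on U (cst c : V -> W).
Proof. by move=> k; exact: Ck_cst. Qed.

Lemma smooth_id (V : normedModType R) (U : set V) : smooth_on U (id : V -> V).
Proof. by move=> k; exact: Ck_id. Qed.

Lemma smooth_sub (V W : normedModType R) (U U' : set V) (f : V -> W) :
  U' `<=` U -> smooth_on U f -> smooth_on U' f.
Proof. by move=> UU' sf k; exact: Ck_sub (sf k). Qed.

Lemma smooth_comp (V W : normedModType R) n (U1 : set V) (U2 : set 'rV[R]_n)
    (f : V -> 'rV[R]_n) (g : 'rV[R]_n -> W) :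
  open U1 -> (forall x, U1 x -> U2 (f x)) ->
  smooth_on U1 f -> smooth_on U2 g -> smooth_on U1 (g \o f).
Proof. by move=> oU fU sf sg k; exact: Ck_comp (sf k) (sg k). Qed.

Lemma smooth_differentiable (V W : normedModType R) (U : set V) (f : V -> W) x :
  smooth_on U f -> U x -> differentiable f x.
Proof. by move=> sf; have [+ _] := sf 1%N; apply. Qed.

Lemma smooth_lsubmx m n (U : set 'rV[R]_(m + n)) :
  open U -> smooth_on U (lsubmx : 'rV[R]_(m + n) -> 'rV[R]_m).
Proof. exact: smooth_linear. Qed.

Lemma smooth_rsubmx m n (U : set 'rV[R]_(m + n)) :
  open U -> smooth_on U (rsubmx : 'rV[R]_(m + n) -> 'rV[R]_n).
Proof. exact: smooth_linear. Qed.

Definition box m n (V : set 'rV[R]_m) (W : set 'rV[R]_n) : set 'rV[R]_(m + n) :=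
  [set z | V (lsubmx z) /\ W (rsubmx z)].

Lemma open_box m n (V : set 'rV[R]_m) (W : set 'rV[R]_n) :
  open V -> open W -> open (box V W).
Proof.
move=> oV oW.
have -> : box V W = (setT `&` lsubmx @^-1` V) `&` (setT `&` rsubmx @^-1` W).
  by rewrite !setTI.
by apply: openI; apply: open_preimage => //; [exact: openT|exact: smooth_lsubmx openT|
  exact: openT|exact: smooth_rsubmx openT].
Qed.

End calculus.

Arguments pdom {R X x} p.

(** * Tangent vectors represented by pointed plots *)

Section pointed_plots.
Context {R : realType}.
Implicit Types X Y : diffSpace R.

Lemma pdom_open X (x : X) (p : pplot x) : open (pdom p).
Proof. exact: plotd_open (pplotP p). Qed.

Lemma plot_sub X n (U V : set 'rV[R]_n) (p : 'rV[R]_n -> X) :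
  open V -> V `<=` U -> plot U p -> plot V p.
Proof. by move=> oV VU pU; apply: (plotd_comp oV (@smooth_id _ _ V) VU pU). Qed.

(** The relation defining the colimit, freed from the domain conditions of
    germs: shrinking [W] to a neighbourhood of 0 on which everything is defined
    does not affect the derivative at 0. *)
Lemma tvec_factor X (x : X) (p q : pplot x) (W : set 'rV[R]_(pdim p))
    (f : 'rV[R]_(pdim p) -> 'rV[R]_(pdim q)) u :
  open W -> W 0 -> smooth_on W f -> f 0 = 0 ->
  (forall w, W w -> p w = q (f w)) ->
  tvec u = tvec ('d f 0 u) :> tangent x.
Proof.
move=> oW W0 sf f0 pqf; apply: tvec_germ.
exists (pdom p `&` (W `&` f @^-1` pdom q)).
have oWf : open (W `&` f @^-1` pdom q) by apply: open_preimage sf _ => //; exact: pdom_open.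
split; split.
- by apply: openI => //; exact: pdom_open.
- by split; [exact: pplot_dom0|split=> //=; rewrite f0; exact: pplot_dom0].
- by move=> w [].
- by apply: smooth_sub sf => w [_ []].
- by move=> w [_ []].
- by [].
- by move=> w [_ [/pqf]].
Qed.

(** The same relation in the tangent bundle, for pointed plots whose base
    points are equal only propositionally. *)
Lemma existT_tvec_factor X (x y : X) (p : pplot x) (q : pplot y)
    (W : set 'rV[R]_(pdim p)) (f : 'rV[R]_(pdim p) -> 'rV[R]_(pdim q)) u :
  open W -> W 0 -> smooth_on W f -> f 0 = 0 ->
  (forall w, W w -> p w = q (f w)) ->
  existT (@tangent R X) x (tvec u) = existT (@tangent R X) y (tvec ('d f 0 u)).
Proof.
move=> oW W0 sf f0 pqf.
have xy : x = y by rewrite -(pplot0 p) -(pplot0 q) -f0 pqf.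
by subst y; congr existT; exact: tvec_factor pqf.
Qed.

Section germ.
Variables (X : diffSpace R) (x : X) (n : nat) (V : set 'rV[R]_n) (s : 'rV[R]_n -> X).
Hypotheses (sV : plot V s) (V0 : V 0) (s0 : s 0 = x).

Let C := connected_component V 0.

Let sC : plot C s.
Proof.
apply: plot_sub sV; last exact: connected_component_sub.
exact/open_component/(plotd_open sV).
Qed.

(** Pointed plots have connected domains, so a plot defined near 0 is cut down to
    the component of 0. *)
Definition germ_pplot : pplot x :=
  PPlot sC (@component_connected _ _ _) (connected_component_refl V0) s0.
End germ.

(** A constant plot factors through itself by the zero map, whose derivative
    vanishes. *)
Lemma tvec_const X (x : X) (p : pplot x) (W : set 'rV[R]_(pdim p)) u :
  open W -> W 0 -> (forall w, W w -> p w = x) -> tvec (p := p) u = 0 :> tangent x.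
Proof.
move=> oW W0 pW.
rewrite (@tvec_factor _ _ p p W (cst 0)) //.
- by rewrite diff_cst linear0.
- exact: smooth_cst.
- by move=> w /pW ->; rewrite pplot0.
Qed.

End pointed_plots.

(** * Local trivializations as total functions *)

Section trivialization.
Context {R : realType}.
Variables (E B : diffSpace R) (pi : smoothMap E B).

(** A diffeomorphism over [V] from the pullback of [pi] along [p] to [V * F], with
    the subtypes stripped off: [Phi v] parametrizes the fiber of [pi] over [p v]
    and [Psi v] is its inverse, only their values for [v] in [V] being relevant;
    smoothness is joint in [v] and the second argument. *)
Definition trivialization (F : diffSpace R) n (V : set 'rV[R]_n) (p : 'rV[R]_n -> B)
    (Phi : 'rV[R]_n -> F -> E) (Psi : 'rV[R]_n -> E -> F) : Prop :=
  [/\ forall v a, V v -> pi (Phi v a) = p v,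
      forall v x, V v -> pi x = p v -> Phi v (Psi v x) = x,
      forall m (W : set 'rV[R]_m) (f : 'rV[R]_m -> 'rV[R]_n) (a : 'rV[R]_m -> F),
        smooth_on W f -> (forall w, W w -> V (f w)) -> plot W a ->
        plot W (fun w => Phi (f w) (a w)) &
      forall m (W : set 'rV[R]_m) (f : 'rV[R]_m -> 'rV[R]_n) (x : 'rV[R]_m -> E),
        smooth_on W f -> (forall w, W w -> V (f w)) -> plot W x ->
        (forall w, W w -> pi (x w) = p (f w)) ->
        plot W (fun w => Psi (f w) (x w))].

(** The point [e] over [p u0] only serves to make [E] and [F] inhabited, so that
    [Phi] and [Psi] can be extended by junk values outside [V]. *)
Lemma local_trivialization (F : diffSpace R) (e : E) n (U : set 'rV[R]_n)
    (p : 'rV[R]_n -> B) (u0 : 'rV[R]_n) :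
  bundle_with_fiber pi F -> plot U p -> U u0 -> p u0 = pi e ->
  exists V (Phi : 'rV[R]_n -> F -> E) (Psi : 'rV[R]_n -> E -> F),
    [/\ open V, V u0, V `<=` U & trivialization V p Phi Psi].
Proof.
move=> bF pU Uu0 pu0; have [C [oC CU triv]] := bF _ _ _ pU.
have [V CV Vu0] : (\bigcup_(V in C) V) u0 by rewrite CU.
have VU : V `<=` U by move=> v Vv; rewrite -CU; exists V.
have [phi [[sphi [psi [spsi phiK psiK]]] phi1]] := triv _ CV.
pose Z := pullback (X := open_domain U) (fun u => p (sval u)) pi.
pose mkU v (Uv : U v) : open_domain U := exist _ v Uv.
pose mkV v (Vv : V v) : open_domain V := exist _ v Vv.
pose mkZ v x (Vv : V v) (px : p v = pi x) : {z : Z | V (sval (sval z).1)} :=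
  exist (fun z : Z => V (sval (sval z).1))
    (exist (fun ux : prod_space (open_domain U) E => p (sval ux.1) = pi ux.2)
       (mkU v (VU _ Vv), x) px) Vv.
pose a0 : F := (phi (mkZ u0 e Vu0 pu0)).2.
pose Phi v a := if pselect (V v) is left Vv then
  (sval (sval (psi (mkV v Vv, a)))).2 else e.
pose Psi v x := if pselect (V v /\ p v = pi x) is left (conj Vv px) then
  (phi (mkZ v x Vv px)).2 else a0.
have psi1 v Vv a : sval (sval (sval (psi (mkV v Vv, a)))).1 = v.
  by rewrite -phi1 psiK.
exists V, Phi, Psi; split=> //; first exact: oC.
split.
- move=> v a Vv; rewrite /Phi; case: pselect => // {}Vv.
  by have /= <- := svalP (sval (psi (mkV v Vv, a))); rewrite psi1.
- move=> v x Vv pix; rewrite /Phi /Psi; case: pselect => // V2.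
  case: pselect => [[V1 px]|[]//]; set z := mkZ v x V1 px.
  rewrite (_ : (mkV v V2, (phi z).2) = phi z) ?phiK //.
  case: (phi z) (phi1 z) => [[v' Vv'] a] /= vE; subst v'.
  by rewrite (Prop_irrelevance Vv' V2).
- move=> m W f a sf fV aW.
  pose g w : prod_space (open_domain V) F :=
    (if pselect (V (f w)) is left Vf then mkV _ Vf else mkV _ Vu0, a w).
  have gW : plot W g.
    split; last exact: aW.
    have oW := plotd_open aW.
    apply: (@plotd_ext _ _ (diffeo (euclid 'rV[R]_n)) _ W f); last by split.
    by move=> w /fV Vf; rewrite /= /g; case: pselect.
  have [_ psiW] : plot (X := prod_space (open_domain U) E) W (sval \o (sval \o (psi \o g))).
    exact: spsi gW.
  apply: plotd_ext psiW => w /fV Vf; rewrite /= /g /Phi.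
  by case: pselect.
- move=> m W f x sf fV xW xf.
  pose h w : {z : Z | V (sval (sval z).1)} :=
    if pselect (V (f w) /\ p (f w) = pi (x w)) is left (conj Vf px) then
      mkZ (f w) (x w) Vf px else mkZ u0 e Vu0 pu0.
  have hW : plot (X := subdiff [set z : Z | V (sval (sval z).1)]) W h.
    have oW := plotd_open xW.
    split.
      apply: (@plotd_ext _ _ (diffeo (euclid 'rV[R]_n)) _ W f); last by split.
      move=> w Ww; rewrite /= /h; case: pselect => [[]|[]] //.
      by split; [exact: fV|rewrite xf].
    apply: plotd_ext xW => w Ww; rewrite /= /h; case: pselect => [[]|[]] //.
    by split; [exact: fV|rewrite xf].
  have [_ phiW] : plot (X := prod_space (open_domain V) F) W (phi \o h) by exact: sphi.
  apply: plotd_ext phiW => w Ww; rewrite /= /h /Psi.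
  by case: pselect => [[]|[]] //; split; [exact: fV|rewrite xf].
Qed.

(** Every section [w |-> Phi (f w) (sigma w)] along [f] is thus the restriction to
    the graph of [f] of a plot in which base and fiber coordinates vary
    independently. *)
Lemma trivialization_box (F : diffSpace R) m n (V : set 'rV[R]_m)
    (p : 'rV[R]_m -> B) (Phi : 'rV[R]_m -> F -> E) (Psi : 'rV[R]_m -> E -> F)
    (W : set 'rV[R]_n) (sigma : 'rV[R]_n -> F) :
  trivialization V p Phi Psi -> open V -> plot W sigma ->
  plot (box V W) (fun z => Phi (lsubmx z) (sigma (rsubmx z))).
Proof.
move=> [_ _ PhiP _] oV sigmaW; have oD := open_box oV (plotd_open sigmaW).
apply: (PhiP _ _ lsubmx (sigma \o rsubmx)).
- exact: smooth_lsubmx.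
- by move=> z [].
- apply: (plotd_comp oD _ _ sigmaW); first exact: smooth_rsubmx.
  by move=> z [].
Qed.

End trivialization.

(** * Vertical tangent vectors *)

Section vertical.
Context {R : realType}.
Variables (E B : diffSpace R) (pi : smoothMap E B) (e : E).
Let b : B := pi e.
Let F : diffSpace R := subdiff (fiber pi b).
Let e' : F := exist (fiber pi b) e (erefl b).

Definition vertical (t : tangent e) : Prop :=
  exists t' : tangent e', tangent_map (inclusion (fiber pi b)) t' = t.

Lemma vertical_lin a s t : vertical s -> vertical t -> vertical (a *: s + t).
Proof.
by move=> [s' <-] [t' <-]; exists (a *: s' + t'); exact: tangent_map_is_linear.
Qed.

Lemma vertical0 : vertical 0.
Proof. by exists 0; exact: raddf0. Qed.

Lemma verticalD s t : vertical s -> vertical t -> vertical (s + t).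
Proof. by move=> vs vt; rewrite -[s]scale1r; exact: vertical_lin. Qed.

Lemma verticalZ a s : vertical s -> vertical (a *: s).
Proof. by move=> vs; rewrite -[_ *: _]addr0; apply: vertical_lin vertical0. Qed.

Lemma verticalN s : vertical s -> vertical (- s).
Proof. by rewrite -scaleN1r; exact: verticalZ. Qed.

Lemma vertical_trans r s t : vertical (s - r) -> vertical (r - t) -> vertical (s - t).
Proof. by move=> sr rt; rewrite -(subrK r s) -addrA; exact: verticalD. Qed.

(** A plot that stays in the fiber near 0 is a plot of the fiber. *)
Lemma vertical_tvec (q : pplot e) (W : set 'rV[R]_(pdim q)) u : open W -> W 0 ->
  (forall w, W w -> pi (q w) = b) -> vertical (tvec (p := q) u).
Proof.
move=> oW W0 qW.
(* [F] is a subtype, so [q] is first made fiber-valued off [W] as well. *)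
pose r w : F := if pselect (fiber pi b (q w)) is left qw then exist _ (q w) qw else e'.
have rE w : W w -> sval (r w) = q w by move=> /qW qw; rewrite /r; case: pselect.
pose V := W `&` pdom q.
have oV : open V by apply: openI => //; exact: pdom_open.
have rV : plot V r.
  apply: (@plotd_ext _ _ (diffeo E) _ V q) => [w [/rE //]|].
  by apply: plot_sub (pplotP q) => // w [].
have V0 : V 0 by split=> //; exact: pplot_dom0.
have r0 : r 0 = e'.
  have := rE _ W0; rewrite pplot0; case: (r 0) => x Fx /= xe; subst x.
  by rewrite (Prop_irrelevance Fx (erefl b)).
exists (tvec (p := germ_pplot rV V0 r0) u).
rewrite tangent_map_tvec.
pose p := push_pplot (inclusion (fiber pi b)) (germ_pplot rV V0 r0).
by rewrite (@tvec_factor _ _ _ p q W id) ?diff_id //; exact: smooth_id.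
Qed.

(** [pi] is constant on the fiber. *)
Lemma vertical_proj t : vertical t -> tangent_map pi t = 0.
Proof.
move=> [t' <-].
rewrite -(tclass_repr t') tangent_map_tclass; elim: (repr t') => /=.
- exact: raddf0.
- by move=> s IH; rewrite raddfN /= IH oppr0.
- by move=> s IHs t0 IHt; rewrite raddfD /= IHs IHt addr0.
- by move=> a s IH; rewrite linearZ /= IH scaler0.
- move=> p u; rewrite tangent_map_tvec.
  pose p2 := push_pplot pi (push_pplot (inclusion (fiber pi b)) p).
  apply: (@tvec_const _ _ _ p2 (pdom p)) => [||w _]; first exact: pdom_open.
    exact: pplot_dom0.
  exact: (svalP (p w)).
Qed.

(** The heart of exactness. In a trivialization along [p], the section [s] with
    constant fiber coordinate [Psi 0 e] lifts [p]. Another plot [q] lying over [p]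
    via [g] reads [w |-> Phi (g w) (sigma w)], hence factors as the graph map
    [w |-> (g w, w)] followed by [(v, w) |-> Phi v (sigma w)]. The vector
    [('d g 0 u, u)] is the sum of [('d g 0 u, 0)], which [s] represents, and of
    [(0, u)], which is represented by the fiber-valued plot
    [w |-> Phi 0 (sigma w)]. So modulo vertical vectors a lift of [p] does not
    depend on the choices made. *)
Lemma vertical_section (F0 : diffSpace R) (p : pplot b) : bundle_with_fiber pi F0 ->
  exists (V : set 'rV[R]_(pdim p)) (s : 'rV[R]_(pdim p) -> E)
    (sV : plot V s) (V0 : V 0) (s0 : s 0 = e),
    (forall v, V v -> pi (s v) = p v) /\
    forall (q : pplot e) (W : set 'rV[R]_(pdim q))
      (g : 'rV[R]_(pdim q) -> 'rV[R]_(pdim p)) u,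
      open W -> W 0 -> smooth_on W g -> g 0 = 0 ->
      (forall w, W w -> pi (q w) = p (g w)) ->
      vertical (tvec (p := q) u - tvec (p := germ_pplot sV V0 s0) ('d g 0 u)).
Proof.
move=> bF.
have [V [Phi [Psi [oV V0 Vp triv]]]] :=
  local_trivialization bF (pplotP p) (pplot_dom0 p) (pplot0 p).
have [piPhi PhiK PhiP PsiP] := triv; pose n := pdim p.
pose s v := Phi v (Psi 0 e).
have sV : plot V s.
  apply: (PhiP _ _ id (cst (Psi 0 e))) => //; first exact: smooth_id.
  exact: plotd_cst.
have s0 : s 0 = e by rewrite /s PhiK // pplot0.
exists V, s, sV, V0, s0; split=> [v Vv|]; first by rewrite piPhi.
move=> q W g u oW W0 sg g0 qg.
pose m := pdim q.
pose W1 : set 'rV[R]_m := pdom q `&` (W `&` g @^-1` V).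
have oW1 : open W1 by apply: openI; [exact: pdom_open|exact: open_preimage].
have W10 : W1 0 by split; [exact: pplot_dom0|split; rewrite //= g0].
have sg1 : smooth_on W1 g by apply: smooth_sub sg => w [_ []].
pose sigma (w : 'rV[R]_m) := Psi (g w) (q w).
have sigmaW : plot W1 sigma.
  apply: PsiP => [||| w [_ [/qg]]] //; first by move=> w [_ []].
  by apply: plot_sub (pplotP q) => // w [].
pose G (z : 'rV[R]_(n + m)) := Phi (lsubmx z) (sigma (rsubmx z)).
have GD : plot (box V W1) G by exact: trivialization_box triv oV sigmaW.
have D0 : box V W1 0 by split; rewrite linear0.
have G0 : G 0 = e by rewrite /G !linear0 /sigma g0 pplot0 PhiK // pplot0.
pose GP : pplot e := germ_pplot GD D0 G0.
have dg : differentiable g 0 by exact: (smooth_differentiable sg).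
have qE : tvec (p := q) u = tvec (p := GP) (row_mx ('d g 0 u) u).
  rewrite (@tvec_factor _ _ _ q GP W1 (fun w => row_mx (g w) w)) //.
  - by rewrite diff_row_mx // diff_id.
  - by apply: smooth_row_mx => //; exact: smooth_id.
  - by rewrite g0 row_mx0.
  - move=> w [_ [Ww Vgw]]; rewrite /= /G row_mxKl row_mxKr /sigma PhiK //.
    exact: qg.
have sE v : tvec (p := germ_pplot sV V0 s0) v = tvec (p := GP) (row_mx v 0).
  rewrite (@tvec_factor _ _ _ (germ_pplot sV V0 s0) GP setT
    (fun w : 'rV[R]_n => row_mx w 0)) //.
  - by rewrite diff_row_mx ?diff_id ?diff_cst //; exact: differentiable_cst.
  - exact: openT.
  - by apply: smooth_row_mx; [exact: openT|exact: smooth_id|exact: smooth_cst].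
  - by rewrite row_mx0.
  - by move=> w _; rewrite /= /G row_mxKl row_mxKr /sigma g0 pplot0.
rewrite qE sE -linearB opp_row_mx add_row_mx subrr subr0 /=.
pose r w := Phi 0 (sigma w).
have rW : plot W1 r by apply: (PhiP _ _ (cst 0)) => //; exact: smooth_cst.
have r0 : r 0 = e by rewrite /r /sigma g0 pplot0 PhiK // pplot0.
have <- : tvec (p := germ_pplot rW W10 r0) u = tvec (p := GP) (row_mx 0 u).
  rewrite (@tvec_factor _ _ _ (germ_pplot rW W10 r0) GP setT
    (fun w : 'rV[R]_m => row_mx 0 w)) //.
  - by rewrite diff_row_mx ?diff_id ?diff_cst //; exact: differentiable_cst.
  - exact: openT.
  - by apply: smooth_row_mx; [exact: openT|exact: smooth_cst|exact: smooth_id].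
  - by rewrite row_mx0.
  - by move=> w _; rewrite /= /G row_mxKl row_mxKr.
apply: (@vertical_tvec _ setT) => //; first exact: openT.
by move=> w _ /=; rewrite /r piPhi // pplot0.
Qed.

End vertical.

(** * Exactness *)

Section tangent_terms.
Context {R : realType}.

Fixpoint push_tterm (X Y : diffSpace R) (f : smoothMap X Y) (x : X) (t : tterm x) :
    tterm (f x) :=
  match t with
  | TZero => TZero (f x)
  | TOpp t => TOpp (push_tterm f t)
  | TAdd s t => TAdd (push_tterm f s) (push_tterm f t)
  | TScale a t => TScale a (push_tterm f t)
  | TVec p u => @TVec R Y (f x) (push_pplot f p) u
  end.

Lemma tclassE (X : diffSpace R) (x : X) (t : tterm x) :
  tclass t = teval (fun p => @tvec R X x p) t.
Proof.
elim: t => [|t IH|s IHs t IHt|a t IH|p u] //=.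
- by rewrite -tanNE IH.
- by rewrite -tanDE IHs IHt.
- by rewrite -tanZE IH.
Qed.

Lemma tclass_push (X Y : diffSpace R) (f : smoothMap X Y) (x : X) (t : tterm x) :
  tclass (push_tterm f t) = tangent_map f (tclass t).
Proof.
rewrite tangent_map_tclass tclassE.
by elim: t => [|t IH|s IHs t IHt|a t IH|p u] //=; rewrite ?IH ?IHs ?IHt.
Qed.

End tangent_terms.

Section exact_sequence.
Context {R : realType}.
Variables (E B : diffSpace R) (pi : smoothMap E B) (e : E).
Hypothesis pi_bundle : diffeological_bundle pi.
Let b : B := pi e.

(** A linear lift [L p] of every generating map [tvec] of the colimit. By
    [vertical_section] these lifts are compatible with morphisms of germs modulo
    vertical vectors, and each generator of the tangent space at [e] is, modulo
    vertical vectors, the lift of its own projection. *)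
Lemma vertical_lift : exists L : forall p : pplot b, {linear 'rV[R]_(pdim p) -> tangent e},
  [/\ forall p u, tangent_map pi (L p u) = tvec u,
      forall (p1 p2 : pplot b) (f : 'rV[R]_(pdim p1) -> 'rV[R]_(pdim p2)) u,
        germ_mor f -> vertical pi (L p1 u - L p2 ('d f 0 u)) &
      forall (q : pplot e) u, vertical pi (tvec (p := q) u - L (push_pplot pi q) u)].
Proof.
have [F0 bF] := pi_bundle.
(* Recording that [L p] comes from a section lets the last clause apply to it. *)
pose P (p : pplot b) (L : {linear 'rV[R]_(pdim p) -> tangent e}) :=
  exists V (s : 'rV[R]_(pdim p) -> E) (sV : plot V s) (V0 : V 0) (s0 : s 0 = e),
    [/\ forall u, L u = tvec (p := germ_pplot sV V0 s0) u,
        forall v, V v -> pi (s v) = p v &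
    forall (q : pplot e) (W : set 'rV[R]_(pdim q))
      (g : 'rV[R]_(pdim q) -> 'rV[R]_(pdim p)) u,
      open W -> W 0 -> smooth_on W g -> g 0 = 0 ->
      (forall w, W w -> pi (q w) = p (g w)) ->
      vertical pi (tvec (p := q) u - L ('d g 0 u))].
have PP p : exists L, P p L.
  have [V [s [sV [V0 [s0 [piS vert]]]]]] := vertical_section p bF.
  pose q := germ_pplot sV V0 s0.
  by exists (@tvec R E e q : {linear 'rV[R]_(pdim q) -> tangent e}),
    V, s, sV, V0, s0; split.
pose L p := projT1 (cid (PP p)).
have LP p : P p (L p) := projT2 (cid (PP p)).
exists L; split.
- move=> p u; have [V [s [sV [V0 [s0 [LE piS _]]]]]] := LP p.
  rewrite LE tangent_map_tvec.
  pose q := push_pplot pi (germ_pplot sV V0 s0).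
  rewrite (@tvec_factor _ _ _ q p V id) ?diff_id //; first exact: plotd_open sV.
  exact: smooth_id.
- move=> p1 p2 f u [W [[oW W0 Wp] [sf fW f0 pf]]].
  have [V [s [sV [V0 [s0 [LE piS _]]]]]] := LP p1.
  have [_ [_ [_ [_ [_ [_ _ vert]]]]]] := LP p2.
  rewrite LE; apply: (vert (germ_pplot sV V0 s0) (V `&` W)) => //.
  + by apply: openI => //; exact: plotd_open sV.
  + by apply: smooth_sub sf => w [].
  + by move=> w [Vw Ww]; rewrite /= piS // pf.
- move=> q u; have [_ [_ [_ [_ [_ [_ _ vert]]]]]] := LP (push_pplot pi q).
  rewrite -{2}[u](diff_id 0); apply: (vert q setT) => //; first exact: openT.
  exact: smooth_id.
Qed.

(** Evaluated on terms, the lifts respect modulo vertical vectors every relation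
    that defines the tangent space at [b]: they induce a map from it to the
    quotient of the tangent space at [e] by the vertical vectors, and composed with
    the projection this map is the quotient map. *)
Lemma kernel_vertical (t : tangent e) : tangent_map pi t = 0 -> vertical pi t.
Proof.
move: t; have [L [_ Lgerm Lpush]] := vertical_lift.
pose H := teval (fun p => L p).
have Hrel s t : trel s t -> vertical pi (H s - H t).
  rewrite /H; elim=> {s t} /=.
  - by move=> t; rewrite subrr; exact: vertical0.
  - by move=> s t _; rewrite -opprB; move/verticalN; rewrite opprK.
  - by move=> s t r _ st _ tr; exact: vertical_trans st tr.
  - by move=> s t _ st; rewrite -opprD; exact: verticalN.
  - move=> s s' t t' _ ss' _ tt'.
    by rewrite opprD addrACA; exact: verticalD.
  - by move=> a s t _ st; rewrite -scalerBr; exact: verticalZ.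
  - by move=> s t r; rewrite addrA subrr; exact: vertical0.
  - by move=> s t; rewrite [X in _ - X]addrC subrr; exact: vertical0.
  - by move=> t; rewrite add0r subrr; exact: vertical0.
  - by move=> t; rewrite addNr subrr; exact: vertical0.
  - by move=> a c t; rewrite scalerA subrr; exact: vertical0.
  - by move=> t; rewrite scale1r subrr; exact: vertical0.
  - by move=> a s t; rewrite scalerDr subrr; exact: vertical0.
  - by move=> a c t; rewrite scalerDl subrr; exact: vertical0.
  - by move=> p u v; rewrite linearD subrr; exact: vertical0.
  - by move=> p a u; rewrite linearZ subrr; exact: vertical0.
  - by move=> p q f u; exact: Lgerm.
have Hpush (t : tterm e) : vertical pi (tclass t - H (push_tterm pi t)).
  rewrite tclassE /H; elim: t => [|t IH|s IHs t IHt|a t IH|p u] /=.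
  - by rewrite subrr; exact: vertical0.
  - by rewrite -opprD; exact: verticalN.
  - by rewrite opprD addrACA; exact: verticalD.
  - by rewrite -scalerBr; exact: verticalZ.
  - exact: Lpush.
move=> t; rewrite -(tclass_repr t) -tclass_push => t0.
have /Hrel : trel (push_tterm pi (repr t)) (TZero b) by apply/tclassP; exact: t0.
rewrite -[X in vertical pi X -> _]/(H _ - 0).
by move/(vertical_trans (Hpush _)); rewrite subr0.
Qed.

Lemma tangent_map_surjective : range (tangent_map pi (x := e)) = [set: tangent b].
Proof.
have [L [piL _ _]] := vertical_lift.
rewrite -subTset => t _; exists (teval (fun p => L p) (repr t)) => //.
rewrite -[RHS]tclass_repr tclassE.
elim: (repr t) => [|s IH|s IHs s' IHs'|a s IH|p u] /=.
- exact: raddf0.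
- by rewrite raddfN /= IH.
- by rewrite raddfD /= IHs IHs'.
- by rewrite linearZ /= IH.
- exact: piL.
Qed.

End exact_sequence.

(** * Plots of the tangent bundle *)

Section local_diffeology.
Context {R : realType}.
Variables (T : Type) (G : forall n, set 'rV[R]_n -> ('rV[R]_n -> T) -> Prop).

Definition locally_in n (U : set 'rV[R]_n) (q : 'rV[R]_n -> T) :=
  forall u, U u -> exists V, [/\ open V, V u, V `<=` U & G V q].

Hypothesis Gext : forall n (U : set 'rV[R]_n) p q,
  (forall u, U u -> p u = q u) -> G U p -> G U q.
Hypothesis Gcst : forall n (U : set 'rV[R]_n) x, open U -> G U (cst x).
Hypothesis Gcomp : forall m n (V : set 'rV[R]_m) (U : set 'rV[R]_n) f p,
  open V -> smooth_on V f -> (forall v, V v -> U (f v)) -> G U p -> G V (p \o f).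

(** The diffeology generated by a family of parametrizations that is stable under
    smooth precomposition and contains the constants: only the locality axiom
    remains to be enforced. *)
Definition local_diffeology : diffeology R T.
Proof.
apply: (@Diffeology _ _ (fun n U q => open U /\ locally_in U q)).
- by move=> n U q [].
- move=> n U p q pq [oU lU]; split=> // u /lU[V [oV Vu VU GV]].
  by exists V; split=> //; apply: Gext GV => v /VU; exact: pq.
- by move=> n U x oU; split=> // u Uu; exists U; split=> //; exact: Gcst.
- move=> m n V U f p oV sf fVU [oU lU]; split=> // v Vv.
  have [W [oW Wfv WU GW]] := lU _ (fVU _ Vv).
  have oVW : open (V `&` f @^-1` W) by exact: open_preimage.
  exists (V `&` f @^-1` W); split=> //.
  apply: Gcomp GW => //; first by apply: smooth_sub sf => ? [].
  by move=> ? [].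
- move=> n U p oU H; split=> // u /H[V [oV Vu VU [_ lV]]].
  have [W [oW Wu WV GW]] := lV _ Vu.
  by exists W; split=> //; exact: subset_trans VU.
Defined.

End local_diffeology.

Section tangent_plots.
Context {R : realType}.
Implicit Types X Y : diffSpace R.

Lemma plot_local X n (U : set 'rV[R]_n) (q : 'rV[R]_n -> X) : open U ->
  locally_in (@plot R X) U q -> plot U q.
Proof. exact: plotd_local. Qed.

Lemma existT_inj X (x : X) (s t : tangent x) :
  existT (@tangent R X) x s = existT (@tangent R X) x t -> s = t.
Proof.
move=> st; have := projT2_eq st; rewrite /=.
by rewrite (Prop_irrelevance (projT1_eq st) erefl).
Qed.

Definition Tmap X Y (f : smoothMap X Y) (s : tangent_bundle X) : tangent_bundle Y :=
  existT _ (f (projT1 s)) (tangent_map f (projT2 s)).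

(** Addition in the fibers as a relation, so that no base points need to be
    transported. *)
Definition fiber_sum X (s t r : tangent_bundle X) :=
  exists x (a b : tangent x),
    [/\ s = existT _ x a, t = existT _ x b & r = existT _ x (a + b)].

(** The functions [Tp \o (f, g)] with [f] and [g] smooth, again with total functions
    in place of maps into a subtype. *)
Definition tangent_gen X n (W : set 'rV[R]_n) (q : 'rV[R]_n -> tangent_bundle X) :=
  exists m (U : set 'rV[R]_m) (p : 'rV[R]_m -> X) (pU : plot U p)
    (f g : 'rV[R]_n -> 'rV[R]_m),
    [/\ open W, smooth_on W f, smooth_on W g &
        forall w, W w -> exists h : U (f w),
          q w = existT _ (p (f w)) (tvec (p := shift_pplot pU h) (g w))].

(** Finite fiberwise sums of such functions. They are stable under smooth scalar
    multiplication because scalars can be absorbed in the vectors [g w]. *)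
Inductive tangent_span X n (W : set 'rV[R]_n) (q : 'rV[R]_n -> tangent_bundle X) : Prop :=
| tangent_span_gen of tangent_gen W q
| tangent_span_add q1 q2 of tangent_span W q1 & tangent_span W q2 &
    forall w, W w -> fiber_sum (q1 w) (q2 w) (q w).

Definition hector_gen X n (W : set 'rV[R]_n) (q : 'rV[R]_n -> tangent_bundle X) :=
  (exists c, forall w, W w -> q w = c) \/ tangent_gen W q.

Lemma Tadd_fiber_sum X
    (st : {st : tangent_bundle X * tangent_bundle X | Tproj st.1 = Tproj st.2}) :
  fiber_sum (sval st).1 (sval st).2 (Tadd st).
Proof.
case: st => -[[x a] [y b]] xy; have xy' : x = y := xy; subst y.
exists x, a, b; split=> //; rewrite /Tadd /=; set h := svalP _.
by rewrite (Prop_irrelevance h erefl).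
Qed.

Lemma fiber_sum_fun X (s t r r' : tangent_bundle X) :
  fiber_sum s t r -> fiber_sum s t r' -> r = r'.
Proof.
move=> [x [a [b [-> -> ->]]]] [y [a' [b' [sE tE ->]]]].
have xy : x = y by have := congr1 (@projT1 _ _) sE.
by case: y / xy a' b' sE tE => a' b' /existT_inj -> /existT_inj ->.
Qed.

Lemma tangent_gen_ext X n (W : set 'rV[R]_n) (p q : 'rV[R]_n -> tangent_bundle X) :
  (forall w, W w -> p w = q w) -> tangent_gen W p -> tangent_gen W q.
Proof.
move=> pq [m [U [r [rU [f [g [oW sf sg rE]]]]]]].
exists m, U, r, rU, f, g; split=> // w Ww.
by have [h pE] := rE _ Ww; exists h; rewrite -pq.
Qed.

Lemma tangent_gen_comp X m n (V : set 'rV[R]_m) (W : set 'rV[R]_n) f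
    (q : 'rV[R]_n -> tangent_bundle X) :
  open V -> smooth_on V f -> (forall v, V v -> W (f v)) ->
  tangent_gen W q -> tangent_gen V (q \o f).
Proof.
move=> oV sf fVW [k [U [p [pU [a [b [oW sa sb qE]]]]]]].
exists k, U, p, pU, (a \o f), (b \o f); split=> //.
- exact: smooth_comp sa.
- exact: smooth_comp sb.
- by move=> v /fVW /qE.
Qed.

Lemma tangent_span_ext X n (W : set 'rV[R]_n) (p q : 'rV[R]_n -> tangent_bundle X) :
  (forall w, W w -> p w = q w) -> tangent_span W p -> tangent_span W q.
Proof.
move=> pq; case=> [pW|p1 p2 p1W p2W p12].
  exact/tangent_span_gen/(tangent_gen_ext pq).
by apply: (tangent_span_add p1W p2W) => w Ww; rewrite -pq //; exact: p12.
Qed.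

Lemma tangent_span_comp X m n (V : set 'rV[R]_m) (W : set 'rV[R]_n) f
    (q : 'rV[R]_n -> tangent_bundle X) :
  open V -> smooth_on V f -> (forall v, V v -> W (f v)) ->
  tangent_span W q -> tangent_span V (q \o f).
Proof.
move=> oV sf fVW; elim=> [{}q qW|{}q q1 q2 _ q1V _ q2V q12].
  exact/tangent_span_gen/(tangent_gen_comp oV sf fVW).
by apply: (tangent_span_add q1V q2V) => v /fVW; exact: q12.
Qed.

Lemma tangent_span_sub X n (V W : set 'rV[R]_n) (q : 'rV[R]_n -> tangent_bundle X) :
  open V -> V `<=` W -> tangent_span W q -> tangent_span V q.
Proof. by move=> oV; apply: (tangent_span_comp oV); exact: smooth_id. Qed.

Lemma tangent_span_scale X n (W : set 'rV[R]_n) (q : 'rV[R]_n -> tangent_bundle X)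
    (r : 'rV[R]_n -> R^o) :
  smooth_on W r -> tangent_span W q -> tangent_span W (fun w => Tscale (q w, r w)).
Proof.
move=> sr; elim=> [{}q [k [U [p [pU [f [g [oW sf sg qE]]]]]]]|{}q q1 q2 _ q1W _ q2W q12].
  apply: tangent_span_gen; exists k, U, p, pU, f, (fun w => r w *: g w); split=> //.
    by move=> i; exact: CkZ.
  by move=> w /qE[h ->]; exists h; rewrite /Tscale /= linearZ.
apply: (tangent_span_add q1W q2W) => w /q12[x [a [b [-> -> ->]]]].
by exists x, (r w *: a), (r w *: b); split; rewrite // /Tscale /= scalerDr.
Qed.

(** A single tangent vector is a linear combination of vectors represented by
    pointed plots, and each of those is the value of a tangent map at 0. *)
Lemma tangent_span_cst X n (W : set 'rV[R]_n) (c : tangent_bundle X) :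
  open W -> tangent_span W (cst c).
Proof.
move=> oW; case: c => x t; rewrite -(tclass_repr t) tclassE.
have scale a s : tangent_span W (cst (existT (@tangent R X) x s)) ->
    tangent_span W (cst (existT (@tangent R X) x (a *: s))).
  move=> /(tangent_span_scale (r := cst a)); apply; exact: smooth_cst.
elim: (repr t) => [|s|s IHs s' IHs'|a s|p u] /=.
- have pU : plot [set: 'rV[R]_0] (cst x : _ -> X) by exact: plotd_cst openT.
  apply: tangent_span_gen; exists 0%N, setT, (cst x), pU, (cst 0), (cst 0).
  by split=> // [||w _]; [exact: smooth_cst|exact: smooth_cst|exists I; rewrite linear0].
- by move=> /(scale (-1)); rewrite scaleN1r.
- apply: (tangent_span_add IHs IHs') => w _; by do 3!eexists.
- exact: scale.
- apply: tangent_span_gen.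
  exists (pdim p), (pdom p), p, (pplotP p), (cst 0), (cst u).
  split=> // [||w _]; [exact: smooth_cst|exact: smooth_cst|].
  exists (pplot_dom0 p); set q := shift_pplot _ _.
  rewrite -{1}[u](diff_id 0); symmetry.
  apply: (@existT_tvec_factor _ _ _ _ q p setT id) => //; first exact: openT.
    exact: smooth_id.
  by move=> v _ /=; rewrite add0r.
Qed.

Lemma tangent_gen_proj X n (W : set 'rV[R]_n) (q : 'rV[R]_n -> tangent_bundle X) :
  tangent_gen W q -> plot W (fun w => Tproj (q w)).
Proof.
move=> [m [U [p [pU [f [g [oW sf sg qE]]]]]]].
have fU w : W w -> U (f w) by move=> /qE[].
by apply: plotd_ext (plotd_comp oW sf fU pU) => w /qE[h ->].
Qed.

Lemma tangent_span_proj X n (W : set 'rV[R]_n) (q : 'rV[R]_n -> tangent_bundle X) :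
  tangent_span W q -> plot W (fun w => Tproj (q w)).
Proof.
elim=> [{}q|{}q q1 q2 _ + _ _ q12]; first exact: tangent_gen_proj.
by apply: plotd_ext => w /q12[x [a [b [-> _ ->]]]].
Qed.

Lemma tangent_gen_plotH X n (W : set 'rV[R]_n) (q : 'rV[R]_n -> tangent_bundle X) :
  tangent_gen W q -> plot (X := THector X) W q.
Proof.
move=> [m [U [p [pU [f [g [oW sf sg qE]]]]]]].
apply: plot_local => // w0 Ww0; exists W; split=> //.
have [h0 _] := qE _ Ww0.
pose a w : open_domain U :=
  if pselect (U (f w)) is left h then exist _ (f w) h else exist _ (f w0) h0.
have aW : plot (X := tangent_domain U) W (fun w => (a w, g w)).
  split; last by split.
  apply: (@plotd_ext _ _ (diffeo (euclid 'rV[R]_m)) _ W f); last by split.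
  by move=> w /qE[h _] /=; rewrite /a; case: pselect.
apply: plotd_ext (THector_is_hector pU aW) => w /qE[h ->] /=.
rewrite /Tplot /a /=; case: pselect => // h'.
by rewrite (Prop_irrelevance h (svalP (exist U (f w) h'))).
Qed.

Lemma tangent_gen_Tplot X m (U : set 'rV[R]_m) (p : 'rV[R]_m -> X) (pU : plot U p)
    n (W : set 'rV[R]_n) (a : 'rV[R]_n -> tangent_domain U) :
  plot W a -> tangent_gen W (Tplot pU \o a).
Proof.
move=> [[oW s1] [_ s2]].
exists m, U, p, pU, (fun w => sval (a w).1), (fun w => (a w).2).
by split=> // w _; exists (svalP (a w).1).
Qed.

(** The functions that locally are constant or of the form [Tp \o (f, g)] make up a
    diffeology containing all [Tp], so it contains the smallest one. *)
Lemma plotHP X n (U : set 'rV[R]_n) (q : 'rV[R]_n -> tangent_bundle X) :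
  plot (X := THector X) U q <-> open U /\ locally_in (@hector_gen X) U q.
Proof.
split; last first.
  move=> [oU qU]; apply: plot_local => // u /qU[V [oV Vu VU [[c qc]|qV]]].
    exists V; split=> //; apply: plotd_ext (plotd_cst (diffeo (THector X)) c oV).
    by move=> v Vv; rewrite qc.
  by exists V; split=> //; exact: tangent_gen_plotH.
have ext k (W : set 'rV[R]_k) p r : (forall w, W w -> p w = r w) ->
    @hector_gen X k W p -> hector_gen W r.
  move=> pr [[c pc]|pW]; last by right; exact: tangent_gen_ext pW.
  by left; exists c => w Ww; rewrite -pr // pc.
have ct k (W : set 'rV[R]_k) x : open W -> @hector_gen X k W (cst x).
  by left; exists x.
have comp k m (V : set 'rV[R]_k) (W : set 'rV[R]_m) f p : open V -> smooth_on V f ->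
    (forall v, V v -> W (f v)) -> @hector_gen X m W p -> hector_gen V (p \o f).
  move=> oV sf fVW [[c pc]|pW]; last by right; exact: tangent_gen_comp pW.
  by left; exists c => v /fVW; exact: pc.
move=> [oU /(_ (local_diffeology ext ct comp))]; apply=> m V p pV k W a aW.
have oW : open W by case: aW => -[].
by split=> // w Ww; exists W; split=> //; right; exact: tangent_gen_Tplot.
Qed.

Lemma tangent_span_plotdvs X n (W : set 'rV[R]_n) (q : 'rV[R]_n -> tangent_bundle X) :
  tangent_span W q -> plot (X := Tdvs X) W q.
Proof.
have [dvsH [_ dvsD _]] := Tdvs_is_dvs X.
elim=> [{}q /tangent_gen_plotH|{}q q1 q2 _ q1W _ q2W q12]; first exact: dvsH.
pose T2 := [set st : prod_space (Tdvs X) (Tdvs X) | Tproj st.1 = Tproj st.2].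
(* The pair [(q1, q2)], replaced by a diagonal pair where the bases differ. *)
pose q12' w : {st | T2 st} := if pselect (T2 (q1 w, q2 w)) is left h
  then exist T2 (q1 w, q2 w) h else exist T2 (q1 w, q1 w) erefl.
pose T2X := pullback (X := Tdvs X) (Y := Tdvs X) (@Tproj R X) (@Tproj R X).
have q12W : plot (X := T2X) W q12'.
  split; [apply: plotd_ext q1W|apply: plotd_ext q2W] => w /q12[x [a [b [q1E q2E _]]]] /=;
    rewrite /q12'; case: pselect => // -[]; by rewrite /T2 /= q1E q2E.
apply: plotd_ext (dvsD _ _ _ q12W) => w Ww.
apply: fiber_sum_fun (q12 _ Ww); have := Tadd_fiber_sum (q12' w).
rewrite /= {1 2}/q12'; case: pselect => // -[].
by have [x [a [b [q1E q2E _]]]] := q12 _ Ww; rewrite /T2 /= q1E q2E.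
Qed.

(** Likewise, the functions that locally are fiberwise sums make up a diffeology
    which contains Hector's and for which the vector space operations are smooth,
    since sums and smooth multiples of fiberwise sums are fiberwise sums. *)
Lemma plotdvsP X n (U : set 'rV[R]_n) (q : 'rV[R]_n -> tangent_bundle X) :
  plot (X := Tdvs X) U q <-> open U /\ locally_in (@tangent_span X) U q.
Proof.
split; last first.
  move=> [oU qU]; apply: plot_local => // u /qU[V [oV Vu VU qV]].
  by exists V; split=> //; exact: tangent_span_plotdvs.
pose D := local_diffeology (@tangent_span_ext X) (@tangent_span_cst X)
  (@tangent_span_comp X).
move=> [oU /(_ D)]; apply; split.
  move=> m W p [oW /(_ D)]; apply=> k V r rV j W' a aW'.
  have oW' : open W' by case: aW' => -[].
  split=> // w Ww; exists W'; split=> //.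
  exact/tangent_span_gen/tangent_gen_Tplot.
split.
- move=> m W p [oW pW]; apply: plot_local => // w /pW[V [oV Vw VW pV]].
  by exists V; split=> //; exact: tangent_span_proj.
- move=> m W p [[oW p1] [_ p2]]; split=> // w Ww.
  have [V1 [oV1 V1w V1W p1V]] := p1 _ Ww.
  have [V2 [oV2 V2w V2W p2V]] := p2 _ Ww.
  exists (V1 `&` V2); split=> [|//|v [/V1W]//|]; first exact: openI.
  apply: (@tangent_span_add _ _ _ _ (fun v => (sval (p v)).1) (fun v => (sval (p v)).2)).
  + by apply: tangent_span_sub p1V => //; exact: openI.
  + by apply: tangent_span_sub p2V => //; exact: openI.
  + by move=> v _; exact: Tadd_fiber_sum.
- move=> m W p [[oW p1] [_ p2]]; split=> // w Ww.
  have [V [oV Vw VW pV]] := p1 _ Ww; exists V; split=> //.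
  apply: tangent_span_ext (tangent_span_scale (r := fun v => (p v).2) _ pV) => [v _|].
    by rewrite /= -surjective_pairing.
  exact: smooth_sub p2.
Qed.

End tangent_plots.

(** * Subductions *)

Section lifting.
Context {R : realType}.

Lemma Tmap_gen (X Y : diffSpace R) (h : smoothMap X Y) n (W : set 'rV[R]_n) q :
  tangent_gen W q -> tangent_gen W (Tmap h \o q).
Proof.
move=> [m [U [p [pU [f [g [oW sf sg qE]]]]]]].
exists m, U, (h \o p), (smfunP h pU), f, g; split=> // w /qE[Uf qw].
exists Uf; rewrite /Tmap /= qw /= tangent_map_tvec.
set p1 := push_pplot _ _; set p2 := shift_pplot _ _.
rewrite -{2}[g w](diff_id 0).
apply: (@existT_tvec_factor _ _ _ _ p1 p2 setT id) => //; first exact: openT.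
exact: smooth_id.
Qed.

Lemma Tmap_sum (X Y : diffSpace R) (h : smoothMap X Y) (s t r : tangent_bundle X) :
  fiber_sum s t r -> fiber_sum (Tmap h s) (Tmap h t) (Tmap h r).
Proof.
move=> [x [a [b [-> -> ->]]]].
exists (h x), (tangent_map h a), (tangent_map h b); split=> //.
by rewrite /Tmap /= raddfD.
Qed.

Lemma Tmap_span (X Y : diffSpace R) (h : smoothMap X Y) n (W : set 'rV[R]_n) q :
  tangent_span W q -> tangent_span W (Tmap h \o q).
Proof.
elim=> [{}q qW|{}q q1 q2 _ q1W _ q2W q12]; first exact/tangent_span_gen/Tmap_gen.
by apply: (tangent_span_add q1W q2W) => w /q12; exact: Tmap_sum.
Qed.

Lemma smooth_TmapH (X Y : diffSpace R) (h : smoothMap X Y) :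
  smooth (X := THector X) (Y := THector Y) (Tmap h).
Proof.
move=> n U q /plotHP[oU qU]; apply/plotHP; split=> // u /qU[V [oV Vu VU qV]].
exists V; split=> //; case: qV => [[c qc]|qV]; last by right; exact: Tmap_gen.
by left; exists (Tmap h c) => v /qc /= ->.
Qed.

Lemma smooth_Tmapdvs (X Y : diffSpace R) (h : smoothMap X Y) :
  smooth (X := Tdvs X) (Y := Tdvs Y) (Tmap h).
Proof.
move=> n U q /plotdvsP[oU qU]; apply/plotdvsP; split=> // u /qU[V [oV Vu VU qV]].
by exists V; split=> //; exact: Tmap_span.
Qed.

(** Locality of plots gives the converse lifting condition for free. *)
Lemma subductionP (X Y : diffSpace R) (f : X -> Y) :
  smooth f -> range f = [set: Y] ->
  (forall n (U : set 'rV[R]_n) (p : 'rV[R]_n -> Y), plot U p ->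
    forall u, U u -> exists V (q : 'rV[R]_n -> X),
      [/\ open V, V u, V `<=` U, plot V q & forall v, V v -> f (q v) = p v]) ->
  subduction f.
Proof.
move=> sf rf lift; split=> // n U p oU; split; first exact: lift.
move=> H; apply: plot_local => // u /H[V [q [oV Vu VU qV fq]]].
by exists V; split=> //; exact: plotd_ext (sf _ _ _ qV).
Qed.

Variables (E B : diffSpace R) (pi : smoothMap E B) (e : E).
Hypothesis pi_bundle : diffeological_bundle pi.

Let atE (t : tangent e) : tangent_bundle E := existT (@tangent R E) e t.
Let atB (t : tangent (pi e)) : tangent_bundle B := existT (@tangent R B) (pi e) t.

(** Here [t w] is represented by [p] translated to [f w] and the vector [g w]. A lift
    of [p] into [E] alone would be based at [e] for a single [w] only, so the lift
    is made to depend on [w] as well: [P] sends [(v, w)] to the point over [p v]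
    whose fiber coordinate is that of [e], regarded as a point over [p (f w)].
    Then [P (f w, w) = e] for all [w], and the vector [(g w, 0)] at [(f w, w)]
    projects to [t w]. *)
Lemma tangent_gen_lift n (W : set 'rV[R]_n) (t : 'rV[R]_n -> tangent (pi e)) w0 :
  tangent_gen W (atB \o t) -> W w0 ->
  exists V (s : 'rV[R]_n -> tangent e),
    [/\ open V, V w0, V `<=` W, tangent_gen V (atE \o s) &
        forall v, V v -> tangent_map pi (s v) = t v].
Proof.
move=> [m [U [p [pU [f [g [oW sf sg tE]]]]]]] Ww0.
have pf w : W w -> p (f w) = pi e.
  by move=> /tE[h /(congr1 (@projT1 _ _))].
have [F0 bF] := pi_bundle; have [Uf0 _] := tE _ Ww0.
have [V [Phi [Psi [oV Vf0 VU triv]]]] :=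
  local_trivialization bF pU Uf0 (pf _ Ww0).
have [piPhi PhiK PhiP PsiP] := triv; pose W' := W `&` f @^-1` V.
have oW' : open W' by exact: open_preimage.
have W'W : W' `<=` W by move=> ? [].
pose sigma w := Psi (f w) e.
have sigmaW : plot W' sigma.
  apply: (PsiP _ _ f (cst e)) => [||| w [/pf]] //; first exact: smooth_sub sf.
    by move=> ? [].
  exact: plotd_cst.
pose P (z : 'rV[R]_(m + n)) := Phi (lsubmx z) (sigma (rsubmx z)).
have PD : plot (box V W') P by exact: trivialization_box triv oV sigmaW.
pose f' w := row_mx (f w) w; pose g' w : 'rV[R]_(m + n) := row_mx (g w) 0.
have Df w : W' w -> box V W' (f' w).
  by move=> W'w; split; rewrite ?row_mxKl ?row_mxKr //; case: W'w.
have Pf w : W' w -> P (f' w) = e.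
  by move=> [Ww Vfw]; rewrite /P /f' row_mxKl row_mxKr /sigma PhiK // pf.
(* The base of the lifted vector is [P (f' w)], which equals [e] only
   propositionally; [s] is the vector transported to [e]. *)
have lift w : exists s : tangent e, W' w ->
    tangent_map pi s = t w /\
    exists h : box V W' (f' w),
      atE s = existT _ (P (f' w)) (tvec (p := shift_pplot PD h) (g' w)).
  have [W'w|] := pselect (W' w); last by exists 0.
  have [Ww Vfw] := W'w; have [Uf tw] := tE _ Ww.
  pose q := shift_pplot PD (Df _ W'w).
  have [s sE] : exists s, atE s = existT (@tangent R E) _ (tvec (p := q) (g' w)).
    rewrite /atE; move: (tvec _); rewrite Pf // => s; by exists s.
  exists s => _; split; last by exists (Df _ W'w).
  apply: existT_inj; rewrite -[LHS]/(Tmap pi (atE s)) -[RHS]/((atB \o t) w) tw sE.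
  rewrite /Tmap /= tangent_map_tvec.
  pose p1 := push_pplot pi q; pose p2 := shift_pplot pU Uf.
  have -> : g w = 'd (lsubmx : 'rV[R]_(m + n) -> 'rV[R]_m) 0 (g' w).
    rewrite [RHS](congr1 (@^~ _) (diff_lin 0 _)) /= ?row_mxKl //.
    exact: linear_rV_continuous.
  pose Q : set 'rV[R]_(m + n) := setT `&` lsubmx @^-1` (setT `&` (+%R (f w)) @^-1` V).
  have oQ : open Q.
    apply: open_preimage; [exact: openT|exact: smooth_lsubmx openT|].
    apply: open_preimage => //; first exact: openT.
    by move=> k; apply: (CkD openT); [exact: Ck_cst|exact: Ck_id].
  apply: (@existT_tvec_factor _ _ _ _ p1 p2 Q lsubmx).
  - exact: oQ.
  - by split=> //; split=> //=; rewrite linear0 addr0.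
  - exact/smooth_lsubmx/oQ.
  - exact: linear0.
  - by move=> z [_ [_ Vz]]; rewrite /= /P linearD /= piPhi /f' row_mxKl.
have {lift}[s sP] := choice lift.
exists W', s; split=> //; last by move=> v /sP[].
exists (m + n)%N, (box V W'), P, PD, f', g'; split=> //.
- by apply: smooth_row_mx; [|exact: smooth_sub sf|exact: smooth_id].
- by apply: smooth_row_mx; [|exact: smooth_sub sg|exact: smooth_cst].
- by move=> w /sP[_ [h sE]]; exists h.
Qed.

(** The summands of a fiberwise sum over [pi e] lie over [pi e] too, so they can be
    lifted separately, to the same point [e]. *)
Lemma tangent_span_lift n (W : set 'rV[R]_n) (t : 'rV[R]_n -> tangent (pi e)) w0 :
  tangent_span W (atB \o t) -> W w0 ->
  exists V (s : 'rV[R]_n -> tangent e),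
    [/\ open V, V w0, V `<=` W, tangent_span V (atE \o s) &
        forall v, V v -> tangent_map pi (s v) = t v].
Proof.
move=> tW Ww0.
suff lift q : tangent_span W q -> forall t, (forall w, W w -> q w = atB (t w)) ->
    exists V (s : 'rV[R]_n -> tangent e),
      [/\ open V, V w0, V `<=` W, tangent_span V (atE \o s) &
          forall v, V v -> tangent_map pi (s v) = t v] by exact: lift tW _ _.
elim=> {tW t} [{}q qW|{}q q1 q2 _ IH1 _ IH2 q12] t qt.
  have [V [s [oV Vw VW sV st]]] := tangent_gen_lift (tangent_gen_ext qt qW) Ww0.
  by exists V, s; split=> //; exact: tangent_span_gen.
have split_t w : exists ab : tangent (pi e) * tangent (pi e), W w ->
    [/\ q1 w = atB ab.1, q2 w = atB ab.2 & t w = ab.1 + ab.2].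
  have [Ww|] := pselect (W w); last by exists (0, 0).
  have [x [a [c [q1E q2E qE]]]] := q12 _ Ww.
  have xE : x = pi e by have := congr1 (@projT1 _ _) (qt _ Ww); rewrite qE.
  subst x; exists (a, c) => _; split=> //.
  by apply: existT_inj; rewrite -qE qt.
have [t12 t12P] := choice split_t.
have q1t w : W w -> q1 w = atB (t12 w).1 by case/t12P.
have q2t w : W w -> q2 w = atB (t12 w).2 by case/t12P.
have [V1 [s1 [oV1 V1w V1W s1V s1t]]] := IH1 (fun w => (t12 w).1) q1t.
have [V2 [s2 [oV2 V2w V2W s2V s2t]]] := IH2 (fun w => (t12 w).2) q2t.
have oV : open (V1 `&` V2) by exact: openI.
exists (V1 `&` V2), (fun w => s1 w + s2 w); split=> //.
- by move=> ? [/V1W].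
- apply: (@tangent_span_add _ _ _ _ _ (atE \o s1) (atE \o s2)).
  + by apply: tangent_span_sub s1V.
  + by apply: tangent_span_sub s2V.
  + by move=> w _; exists e, (s1 w), (s2 w).
- move=> v [V1v V2v]; rewrite raddfD /= s1t // s2t //.
  by have [_ _ ->] := t12P _ (V1W _ V1v).
Qed.

Lemma subductionH :
  subduction (X := tangentH e) (Y := tangentH (pi e)) (tangent_map pi (x := e)).
Proof.
have surj := tangent_map_surjective e pi_bundle.
apply: subductionP => //.
  by move=> n U q qU; exact: (smooth_TmapH pi qU).
move=> n U t /plotHP[oU tU] u /[dup] Uu /tU[V [oV Vu VU [[c tc]|tV]]].
  have [s _ sE] : range (tangent_map pi (x := e)) (t u) by rewrite surj.
  exists V, (cst s); split=> // [|v Vv]; first exact: plotd_cst.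
  rewrite sE; apply: existT_inj.
  by rewrite -[LHS]/((atB \o t) u) -[RHS]/((atB \o t) v) !tc.
have [V' [s [oV' V'u V'V sV' st]]] := tangent_gen_lift tV Vu.
exists V', s; split=> //; first exact: subset_trans VU.
exact: tangent_gen_plotH.
Qed.

Lemma subduction_dvs :
  subduction (X := tangent_dvs e) (Y := tangent_dvs (pi e)) (tangent_map pi (x := e)).
Proof.
have surj := tangent_map_surjective e pi_bundle.
apply: subductionP => //.
  by move=> n U q qU; exact: (smooth_Tmapdvs pi qU).
move=> n U t /plotdvsP[oU tU] u /[dup] Uu /tU[V [oV Vu VU tV]].
have [V' [s [oV' V'u V'V sV' st]]] := tangent_span_lift tV Vu.
exists V', s; split=> //; first exact: subset_trans VU.
exact: tangent_span_plotdvs.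
Qed.

End lifting.

Theorem theorem1 (R : realType) (E B : diffSpace R) (pi : smoothMap E B) (e : E)
    (pi_bundle : diffeological_bundle pi) :
  let b : B := pi e in
  let F : diffSpace R := subdiff (fiber pi b) in
  let iota : smoothMap F E := inclusion (fiber pi b) in
  let e' : F := exist (fiber pi b) e (erefl b) in
  let iota_e : {linear tangent e' -> tangent (iota e')} := tangent_map iota (x := e') in
  let pi_e : {linear tangent e -> tangent b} := tangent_map pi (x := e) in
  [/\ exact_at iota_e pi_e,
      range pi_e = [set: tangent b],
      subduction (X := tangentH e) (Y := tangentH b) pi_e &
      subduction (X := tangent_dvs e) (Y := tangent_dvs b) pi_e].
Proof.
move=> b F iota e' iota_e pi_e.
have surj := tangent_map_surjective e pi_bundle.
split=> //; [|exact: subductionH|exact: subduction_dvs].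
apply/seteqP; split=> [_ [t' _ <-]|t t0]; first by apply: vertical_proj; exists t'.
by have [t' <-] := kernel_vertical pi_bundle t0; exists t'.
Qed.
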